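(* Let $d\ge 1$, let $f:\mathbb{R}_+\times\mathbb{R}^d\to\mathbb{R}^d$, $(t,x)\mapsto f(t,x)$, be a continuous function and let $x_0\in\mathbb{R}^d$. Suppose that: (C1) $f$ is continuous in the second variable uniformly with respect to the first one, i.e. for every $x\in\mathbb{R}^d$ and every $\eta>0$ there is $\kappa>0$ such that $|f(t,x')-f(t,x)|<\eta$ for all $t\in\mathbb{R}_+$ and all $x'\in\mathbb{R}^d$ with $|x'-x|<\kappa$; (C2) for all $x\in\mathbb{R}^d$ the limit $F(x):=\lim_{T\to\infty}\frac1T\int_0^T f(t,x)\,dt$ exists; (C3) the initial value problem $\dot y(t)=F(y(t))$, $y(0)=x_0$, has a unique solution. Let $y$ be the solution of the problem in (C3) and let $L\in J$, where $J$ is the positive interval of definition of $y$. Then for every $\delta>0$ there exists $\varepsilon_0=\varepsilon_0(L,\delta)>0$ such that, for all $\varepsilon\in(0,\varepsilon_0]$, every solution $x$ of the initial value problem $$\dot x(t)=f(t/\varepsilon,x(t)),\qquad x(0)=x_0,$$ is defined at least on $[0,L]$ and satisfies $|x(t)-y(t)|<\delta$ for all $t\in[0,L]$.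
   Context: $\mathbb{R}_+=[0,\infty)$ and $|\cdot|$ is a norm on $\mathbb{R}^d$. Solutions are considered forward in time from $t=0$ and are understood to be maximal (non-continuable to the right). ''Unique solution'' means that there is exactly one maximal solution and every solution is a restriction of it; its positive interval of definition $J$ is of the form $[0,\omega)$ with $0<\omega\le\infty$. (Under (C1) and (C2) the function $F$ is continuous.) *)

(* Defs.v *)
From HB Require Import structures.
From mathcomp Require Import all_boot all_order all_algebra.
From mathcomp Require Import all_classical all_reals all_analysis.

Set Implicit Arguments.
Unset Strict Implicit.
Unset Printing Implicit Defensive.

Import Order.TTheory GRing.Theory Num.Theory.
Import numFieldNormedType.Exports.

Local Open Scope classical_set_scope.
Local Open Scope ring_scope.

(* An arbitrary norm on R^d.  Limits, continuity and derivatives below use the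
   canonical topology of ['rV[R]_d], which is the one every such norm induces. *)
Definition is_norm (R : realType) (d : nat) (N : 'rV[R]_d -> R) : Prop :=
  [/\ forall u v, N (u + v) <= N u + N v,
      forall (a : R) u, N (a *: u) = `|a| * N u
    & forall u, N u = 0 -> u = 0].

Definition forward_interval (R : realType) (I : set R) : Prop :=
  [/\ is_interval I, I 0, I `<=` [set t | 0 <= t] & exists2 t, 0 < t & I t].

(* Derivative relative to I: one-sided at the endpoints that belong to I, the
   usual derivative at interior points.  Values of x outside I are irrelevant. *)
Definition has_deriv_within (R : realType) (d : nat) (I : set R)
    (x : R -> 'rV[R]_d) (t : R) (v : 'rV[R]_d) : Prop :=
  (fun s : R => (s - t)^-1 *: (x s - x t)) @ within I t^' --> v.

Section InitialValueProblem.
Variables (R : realType) (d : nat).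
Variables (g : R -> 'rV[R]_d -> 'rV[R]_d) (x0 : 'rV[R]_d).

Definition solution (I : set R) (x : R -> 'rV[R]_d) : Prop :=
  [/\ forward_interval I, x 0 = x0
    & forall t, I t -> has_deriv_within I x t (g t (x t))].

Definition restriction_of (I : set R) (z : R -> 'rV[R]_d)
    (J : set R) (y : R -> 'rV[R]_d) : Prop :=
  I `<=` J /\ forall t, I t -> z t = y t.

Definition maximal_solution (I : set R) (x : R -> 'rV[R]_d) : Prop :=
  solution I x /\
  forall I' x', solution I' x' -> restriction_of I x I' x' -> I' = I.

(* Two functions agreeing on their common domain are the same solution. *)
Definition has_unique_solution : Prop :=
  exists J y,
    [/\ maximal_solution J y,
        forall I z, maximal_solution I z -> I = J /\ forall t, J t -> z t = y t
      & forall I z, solution I z -> restriction_of I z J y].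

End InitialValueProblem.

Definition time_average (R : realType) (d : nat)
    (f : R -> 'rV[R]_d -> 'rV[R]_d) (x : 'rV[R]_d) (T : R) : 'rV[R]_d :=
  T^-1 *: \row_(i < d) \int[lebesgue_measure]_(t in `[0, T]) f t x 0 i.

(* Meaningful at x only if the limit exists. *)
Definition averaged (R : realType) (d : nat)
    (f : R -> 'rV[R]_d -> 'rV[R]_d) (x : 'rV[R]_d) : 'rV[R]_d :=
  lim (time_average f x @ +oo).

(* Main.v *)
(** Suppose the conclusion fails along a sequence eps_n -> 0 with solutions x_n,
    and take limits along an ultrafilter containing the tails of the sequence.
    For fixed p, condition (C2) gives a primitive Phi of f(t/eps, p) that is
    uniformly close to t F(p), and by (C1) the derivative of x_n - Phi is small
    as long as x_n stays near p.  Hence the x_n are Lipschitz up to errors that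
    vanish in the limit, although f itself may be unbounded in time; their
    pointwise ultralimit exists and is differentiable with derivative F, so by
    (C3) it is y.  This propagates along [0, L] by real induction: near y(c) a
    maximal solution x_n cannot stop within a fixed time h, because a maximal
    solution that stays bounded cannot end in finite time.  The latter rests on
    Peano's existence theorem, which follows by taking the ultralimit of Euler
    schemes. *)

Require Import Defs.
From HB Require Import structures.
From mathcomp Require Import all_boot all_order all_algebra.
From mathcomp Require Import all_classical all_reals all_analysis.
From mathcomp Require Import ring lra.

Set Implicit Arguments.
Unset Strict Implicit.
Unset Printing Implicit Defensive.

Import Order.TTheory GRing.Theory Num.Theory.
Import numFieldNormedType.Exports.

Local Open Scope classical_set_scope.
Local Open Scope ring_scope.

(** * Real induction and the mean value inequality *)

Lemma subrACA (V : zmodType) (a b c d : V) :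
  (a - b) - (c - d) = (a - c) - (b - d).
Proof. by rewrite !opprD !opprK addrACA. Qed.

(** Let [S] collect the points up to which [P] holds without a gap. The closure hypothesis puts
    [sup S] in [S], and the extension hypothesis would push past it if it were below [b]. *)
Lemma real_induction (R : realType) (P : R -> Prop) (a b : R) :
  P a ->
  (forall c, a <= c < b -> (forall r, a <= r <= c -> P r) ->
     exists2 c', c < c' & forall r, c <= r <= c' -> P r) ->
  (forall c, a < c <= b -> (forall r, a <= r < c -> P r) -> P c) ->
  forall r, a <= r <= b -> P r.
Proof.
move=> Pa Pright Pleft r0 /andP[ar0 r0b].
pose S := [set c | a <= c <= b /\ forall r, a <= r <= c -> P r].
have Sa : S a.
  split=> [|r]; first by lra.
  by move=> /le_anti <-.
have supS : has_sup S.
  by split; [exists a | exists b => c [/andP[]]].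
have aS : a <= sup S by apply: (sup_upper_bound supS).
have Sb : sup S <= b by apply: ge_sup; [exists a | move=> c [/andP[]]].
have Plt r : a <= r < sup S -> P r.
  move=> /andP[ar rS].
  have [c [_ Pc] rc] : exists2 c, S c & r < c.
    have rS0 : 0 < sup S - r by lra.
    have [c Sc cr] := sup_adherent rS0 supS.
    by exists c => //; lra.
  by apply: Pc; lra.
have PS : P (sup S).
  have [Sea|aSn] := eqVneq (sup S) a; first by rewrite Sea.
  by apply: Pleft => //; rewrite Sb lt_neqAle eq_sym aSn aS.
have Ple r : a <= r <= sup S -> P r.
  move=> /andP[ar]; rewrite le_eqVlt => /predU1P[->//|rS].
  by apply: Plt; lra.
apply: (Ple); rewrite ar0 /=; case: leP => // Sr0.
have [|c' Sc' Pc'] := Pright (sup S) _ Ple; first by lra.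
suff : S (Order.min c' b).
  move/(sup_upper_bound supS); rewrite ge_min => /orP[]; lra.
split.
  by rewrite le_min ge_min lexx orbT andbT; apply/andP; split; lra.
move=> r /andP[ar]; rewrite le_min => /andP[rc' rb].
by case: (leP r (sup S)) => Sr; [apply: Ple|apply: Pc']; lra.
Qed.

Section DerivOn.
Context {R : realType} {V : normedModType R}.
Implicit Types (I A B : set R) (x y w : R -> V) (v : V).

(** The difference quotient is multiplied out: nothing is divided, [s = t] needs no exclusion, and
    the inequality survives limits along an ultrafilter. *)
Definition deriv_on I x (t : R) v : Prop :=
  forall eta : R, 0 < eta -> exists2 rho : R, 0 < rho &
    forall s, I s -> `|s - t| < rho ->
      `|x s - x t - (s - t) *: v| <= eta * `|s - t|.

Lemma sub_deriv_on I A x t v : A `<=` I -> deriv_on I x t v -> deriv_on A x t v.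
Proof.
move=> AI xv eta eta0; have [rho rho0 xrho] := xv _ eta0.
by exists rho => // s /AI; apply: xrho.
Qed.

(** Locality in both the function and the set. It transports derivatives to an extension of a
    solution, whose domain agrees with the old one near [t]. *)
Lemma deriv_on_local I A x y t v : x t = y t ->
  (exists2 rho : R, 0 < rho &
     forall s, A s -> `|s - t| < rho -> I s /\ y s = x s) ->
  deriv_on I x t v -> deriv_on A y t v.
Proof.
move=> xyt [rho rho0 Arho] xv eta eta0; have [rho' rho'0 xrho] := xv _ eta0.
exists (Order.min rho rho'); first by rewrite lt_min rho0.
move=> s As; rewrite lt_min => /andP[s1 s2].
by have [Is ->] := Arho s As s1; rewrite -xyt; apply: xrho.
Qed.

Lemma deriv_on_setU A B x t v :
  deriv_on A x t v -> deriv_on B x t v -> deriv_on (A `|` B) x t v.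
Proof.
move=> xA xB eta eta0.
have [r1 r10 x1] := xA _ eta0; have [r2 r20 x2] := xB _ eta0.
exists (Order.min r1 r2); first by rewrite lt_min r10.
by move=> s [As|Bs]; rewrite lt_min => /andP[s1 s2]; [apply: x1|apply: x2].
Qed.

Lemma deriv_on_lipschitz I x t v : deriv_on I x t v ->
  forall K : R, `|v| < K -> exists2 rho : R, 0 < rho &
    forall s, I s -> `|s - t| < rho -> `|x s - x t| <= K * `|s - t|.
Proof.
move=> xv K vK; have [|rho rho0 xrho] := xv (K - `|v|); first by lra.
exists rho => // s Is srho; have le1 := xrho s Is srho.
have -> : x s - x t = (x s - x t - (s - t) *: v) + (s - t) *: v by rewrite subrK.
by rewrite (le_trans (ler_normD _ _))// normrZ; lra.
Qed.

Lemma deriv_on_continuous I x t v : deriv_on I x t v ->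
  forall e : R, 0 < e -> exists2 rho : R, 0 < rho &
    forall s, I s -> `|s - t| < rho -> `|x s - x t| < e.
Proof.
move=> xv e e0; have K0 : 0 < `|v| + 1 by rewrite ltr_wpDl.
have [|rho rho0 xrho] := deriv_on_lipschitz (K := `|v| + 1) xv; first by rewrite ltrDl.
exists (Order.min rho (e / (`|v| + 1))); first by rewrite lt_min rho0 divr_gt0.
move=> s Is; rewrite lt_min => /andP[s1 s2].
apply: le_lt_trans (xrho s Is s1) _.
by rewrite mulrC -ltr_pdivlMr.
Qed.

Lemma deriv_onB I x y t v v' : deriv_on I x t v -> deriv_on I y t v' ->
  deriv_on I (fun s => x s - y s) t (v - v').
Proof.
move=> xv yw eta eta0; have eta20 : 0 < eta / 2 by lra.
have [r1 r10 x1] := xv _ eta20; have [r2 r20 x2] := yw _ eta20.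
exists (Order.min r1 r2); first by rewrite lt_min r10.
move=> s Is; rewrite lt_min => /andP[s1 s2].
have -> : x s - y s - (x t - y t) - (s - t) *: (v - v') =
    (x s - x t - (s - t) *: v) - (y s - y t - (s - t) *: v').
  by rewrite scalerBr (subrACA (x s)) (subrACA (x s - x t)).
apply: le_trans (ler_normB _ _) _.
by have := x1 s Is s1; have := x2 s Is s2; lra.
Qed.

Lemma deriv_on_line I t v : deriv_on I (fun s => s *: v) t v.
Proof.
move=> eta eta0; exists 1 => // s _ _.
by rewrite -scalerBl subrr normr0 mulr_ge0// ltW.
Qed.

(** The radius may depend on the point, but the constant [K] does not. Bounds with a common constant
    add up along a chain of points, so real induction carries the estimate from [a] to [b]. *)
Lemma lipschitz_segment w (K a b : R) : a <= b ->
  (forall c, a <= c <= b -> exists2 rho : R, 0 < rho &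
     forall s, a <= s <= b -> `|s - c| < rho -> `|w s - w c| <= K * `|s - c|) ->
  `|w b - w a| <= K * (b - a).
Proof.
move=> ab wK.
pose P r := `|w r - w a| <= K * (r - a).
have step c r : P c -> c <= r -> `|w r - w c| <= K * (r - c) -> P r.
  rewrite /P => Pc cr wr.
  have -> : w r - w a = (w r - w c) + (w c - w a) by rewrite addrA subrK.
  by apply: le_trans (ler_normD _ _) _; lra.
apply: (@real_induction _ P a b).
- by rewrite /P !subrr !normr0 mulr0.
- move=> c /andP[ac cb] Pc; have [|rho rho0 wrho] := wK c; first by lra.
  exists (Order.min (c + rho / 2) b); first by rewrite lt_min cb andbT; lra.
  move=> r; rewrite le_min => /and3P[cr r1 r2].
  have cr0 : 0 <= r - c by lra.
  apply: (step c) => //; first by apply: Pc; lra.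
  by rewrite -(ger0_norm cr0); apply: wrho; rewrite ?ger0_norm//; lra.
- move=> c /andP[ac cb] Pc; have [|rho rho0 wrho] := wK c; first by lra.
  pose r := Order.max a (c - rho / 2).
  have ar : a <= r by rewrite le_max lexx.
  have rc : r < c by rewrite gt_max ac /=; lra.
  have crho : c - rho / 2 <= r by rewrite le_max lexx orbT.
  have rc0 : 0 <= c - r by lra.
  apply: (step r); [by apply: Pc; lra|by lra|].
  have rcE : `|r - c| = c - r by rewrite distrC ger0_norm.
  by rewrite distrC -rcE; apply: wrho; lra.
- by lra.
Qed.

(** The difference [x - y] has derivative of norm at most [eta], hence is locally Lipschitz with
    constant [eta + k] for every [k > 0], and [k] tends to 0. Taking a line or a primitive for [y]
    gives all later uses. *)
Lemma mean_value_dist A x y (x' y' : R -> V) (eta s t : R) : is_interval A ->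
  A s -> A t ->
  (forall c, A c -> deriv_on A x c (x' c)) ->
  (forall c, A c -> deriv_on A y c (y' c)) ->
  (forall c, A c -> `|x' c - y' c| <= eta) ->
  `|(x s - x t) - (y s - y t)| <= eta * `|s - t|.
Proof.
move=> itvA; wlog ts : s t / t <= s.
  move=> H As At; have [ts|/ltW st] := leP t s; first exact: H.
  move=> dx dy xy; have := H t s st At As dx dy xy.
  by rewrite (distrC t s) -(opprB (x s)) -(opprB (y s)) -opprD normrN.
move=> As At dx dy xy; rewrite [`|s - t|]ger0_norm ?subr_ge0//.
apply/ler_addgt0Pr => e e0.
(* The term [+ 1] covers [s = t] and still gives [k * (s - t) <= e]. *)
pose k := e / (s - t + 1).
have k0 : 0 < k by rewrite divr_gt0//; lra.
have -> : x s - x t - (y s - y t) = (x s - y s) - (x t - y t).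
  exact: subrACA.
apply: (@le_trans _ _ ((eta + k) * (s - t))).
  apply: (@lipschitz_segment (fun r => x r - y r)) => // c ctv.
  have Ac : A c by exact: (itvA t s).
  have [] := deriv_on_lipschitz (K := eta + k) (deriv_onB (dx c Ac) (dy c Ac)).
    by have := xy c Ac; lra.
  move=> rho rho0 H; exists rho => // r rts; apply: H.
  exact: (itvA t s).
rewrite mulrDl lerD2l /k mulrAC ler_pdivrMr; last by lra.
by rewrite ler_pM2l//; lra.
Qed.

End DerivOn.

Lemma has_deriv_withinP {R : realType} {d : nat} (I : set R)
    (x : R -> 'rV[R]_d) t v :
  has_deriv_within I x t v <-> deriv_on I x t v.
Proof.
split.
  move=> /cvgrPdist_lt xv eta eta0; have /= [rho rho0 H] := xv _ eta0.
  exists rho => // s Is srho.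
  have [->|st] := eqVneq s t.
    by rewrite !subrr scale0r subrr !normr0 mulr0.
  have st0 : s - t != 0 by rewrite subr_eq0.
  have /= := H s; rewrite distrC => /(_ srho st Is)/ltW le1.
  have -> : x s - x t - (s - t) *: v =
      - ((s - t) *: (v - (s - t)^-1 *: (x s - x t))).
    by rewrite scalerBr scalerA divff// scale1r opprB.
  by rewrite normrN normrZ mulrC ler_wpM2r.
move=> xv; apply/cvgrPdist_lt => e e0; have e20 : 0 < e / 2 by lra.
have [rho rho0 H] := xv _ e20.
exists rho => //= s /=; rewrite distrC => srho st Is.
have st0 : s - t != 0 by rewrite subr_eq0.
have -> : v - (s - t)^-1 *: (x s - x t) =
   - ((s - t)^-1 *: (x s - x t - (s - t) *: v)).
  by rewrite [in RHS]scalerBr scalerA mulVf// scale1r opprB.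
rewrite normrN normrZ normfV mulrC ltr_pdivrMr ?normr_gt0//.
apply: le_lt_trans (H s Is srho) _.
by rewrite ltr_pM2r ?normr_gt0//; lra.
Qed.

(** * Compactness and limits along ultrafilters *)

Lemma compact_norm_le (R : realType) d (B : R) :
  compact [set v : 'rV[R]_d | `|v| <= B].
Proof.
apply: bounded_closed_compact.
  exists B; split; first exact: num_real.
  by move=> M BM v /= vB; apply: le_trans vB (ltW BM).
apply: (@closed_comp _ _ (fun v : 'rV[R]_d => `|v|) [set r | r <= B]).
  by move=> v _; exact: norm_continuous.
exact: closed_le.
Qed.

Section UltraLimits.
Context {R : realType} {T : Type} (U : set_system T) {UU : UltraFilter U}.

(** Compactness yields a cluster point. An ultrafilter contains the preimage of each neighbourhood
    or its complement, and the complement would contradict clustering, so the cluster point is a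
    limit. *)
Lemma ultra_cvg_compact {X : topologicalType} (K : set X) (u : T -> X) :
  compact K -> (\forall n \near U, K (u n)) ->
  exists2 l : X, K l & u @ U --> l.
Proof.
move=> cK uK; have [l [Kl cl]] := cK (u @ U) _ uK.
exists l => // W Wl; rewrite /nbhs/=.
have [//|UC] := in_ultra_setVsetC (u @^-1` W) UU.
have [z [Wz nWz]] : (~` W `&` W) !=set0 by apply: cl.
by case: Wz.
Qed.

Lemma ultra_cvg_bounded d (u : T -> 'rV[R]_d) (B : R) :
  (\forall n \near U, `|u n| <= B) -> exists l : 'rV[R]_d, u @ U --> l.
Proof.
by case/(ultra_cvg_compact (compact_norm_le (B := B))) => l _ ul; exists l.
Qed.

(** The slack [e] lets estimates with errors that vanish along [U] become exact in the limit. The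
    set of good indices may depend on [e]. *)
Lemma ultra_cvg_dist_le {V : normedModType R} (u : T -> V) l a (b : R) :
  u @ U --> l ->
  (forall e : R, 0 < e -> \forall n \near U, `|u n - a| <= b + e) ->
  `|l - a| <= b.
Proof.
move=> ul ub; apply/ler_addgt0Pr => e e0; have e20 : 0 < e / 2 by lra.
move/cvgrPdist_lt : ul => /(_ _ e20) near1.
have [n [n1 n2]] : exists n, `|l - u n| < e / 2 /\ `|u n - a| <= b + e / 2.
  by apply: (@filter_ex _ U); apply: filterS2 near1 (ub _ e20).
have -> : l - a = (l - u n) + (u n - a) by rewrite addrA subrK.
by apply: le_trans (ler_normD _ _) _; lra.
Qed.

End UltraLimits.

(** * Existence and continuation of solutions *)

Lemma joint_continuity (R : realType) d (g : R -> 'rV[R]_d -> 'rV[R]_d) t u :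
  continuous (fun p : R * 'rV[R]_d => g p.1 p.2) ->
  forall e : R, 0 < e -> exists2 rho : R, 0 < rho &
    forall s w, `|s - t| < rho -> `|w - u| < rho -> `|g s w - g t u| < e.
Proof.
move=> cg e e0; move/cvgrPdist_lt: (cg (t, u)) => /(_ e e0).
case=> -[A B] /= [/nbhs_ballP[r1 /= r10 sub1] /nbhs_ballP[r2 /= r20 sub2]] sub.
exists (Order.min r1 r2); first by rewrite lt_min r10.
move=> s w; rewrite !lt_min => /andP[s1 _] /andP[_ w2].
rewrite distrC; apply: (sub (s, w)); split => /=.
  by apply: sub1; rewrite -ball_normE /ball_ /= distrC.
by apply: sub2; rewrite -ball_normE /ball_ /= distrC.
Qed.

Lemma natr_dist_between (R : realDomainType) (i j k : nat) :
  (minn j k <= i < maxn j k)%N -> `|i%:R - j%:R| <= `|k%:R - j%:R| :> R.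
Proof.
have [jk|/ltnW kj] := leqP j k => /andP[lo hi].
  have le1 : j%:R <= i%:R :> R by rewrite ler_nat.
  have le2 : i%:R <= k%:R :> R by rewrite ler_nat ltnW.
  by rewrite ger0_norm ?ger0_norm ?subr_ge0 ?(le_trans le1)// lerB.
have le1 : k%:R <= i%:R :> R by rewrite ler_nat.
have le2 : i%:R <= j%:R :> R by rewrite ler_nat ltnW.
by rewrite ler0_norm ?ler0_norm ?subr_le0 ?(le_trans le1)// lerN2 lerB.
Qed.

Section Euler.
Context {R : realType} {V : normedModType R}.
Variables (g : R -> V -> V) (a : R) (q : V) (dl : R).
Hypothesis dl_ge0 : 0 <= dl.

Fixpoint euler (k : nat) : V :=
  if k is k'.+1 then euler k' + dl *: g (a + k'%:R * dl) (euler k') else q.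

(** A discrete mean value inequality: each step contributes [dl] times a slope within [eta] of [v].
    Using [minn] and [maxn] treats both orders of the indices, and [v = 0] gives a Lipschitz
    bound. *)
Lemma euler_increment (v : V) (eta : R) (j k : nat) :
  (forall i, (minn j k <= i < maxn j k)%N ->
     `|g (a + i%:R * dl) (euler i) - v| <= eta) ->
  `|euler k - euler j - ((k%:R - j%:R) * dl) *: v| <=
    eta * (`|k%:R - j%:R| * dl).
Proof.
wlog jk : j k / (j <= k)%N => [H|].
  have [|kj] := orP (leq_total j k); first exact: H.
  move=> gv; have := H _ _ kj; rewrite minnC maxnC => /(_ gv).
  rewrite -normrN opprD opprB -scaleNr -mulNr opprB.
  by rewrite [X in _ * (X * _)]distrC.
rewrite -(subnKC jk); move: (k - j)%N => m; rewrite (minn_idPl (leq_addr _ _)).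
rewrite (maxn_idPr (leq_addr _ _)) natrD [_ + m%:R]addrC addrK normr_nat.
elim: m => [_|m IH gv].
  by rewrite addn0 subrr !mul0r scale0r subrr normr0 mulr0.
have le1 : `|euler (j + m) - euler j - (m%:R * dl) *: v| <= eta * (m%:R * dl).
  by apply: IH => i /andP[ji im]; apply: gv; rewrite ji addnS ltnW.
have le2 := gv (j + m)%N; rewrite leq_addr addnS ltnSn in le2.
have {}le2 := le2 isT.
rewrite addnS /=.
set G := g _ _ in le2 *.
have -> : euler (j + m) + dl *: G - euler j - (m.+1%:R * dl) *: v =
  (euler (j + m) - euler j - (m%:R * dl) *: v) + dl *: (G - v).
  rewrite -natr1 mulrDl mul1r scalerDl scalerBr opprD.
  by rewrite [RHS]addrACA [euler (j + m) + dl *: G - euler j]addrAC.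
apply: le_trans (ler_normD _ _) _; rewrite normrZ (ger0_norm dl_ge0).
have : dl * `|G - v| <= dl * eta by rewrite ler_wpM2l.
by rewrite -natr1; lra.
Qed.

(** Here [j] and [k] are the grid cells of [t] and [s]. Rounding to the grid costs at most one step
    for a difference of indices and a second one for the distance to [t] itself. *)
Lemma grid_between (h s t : R) (i j k : nat) :
  t - a <= h -> s - a <= h ->
  j%:R * dl <= t - a < j%:R * dl + dl -> k%:R * dl <= s - a < k%:R * dl + dl ->
  (minn j k <= i < maxn j k)%N ->
  [/\ i%:R * dl <= h, `|i%:R - j%:R| * dl <= `|s - t| + dl
    & `|a + i%:R * dl - t| <= `|s - t| + 2 * dl].
Proof.
move=> th sh /andP[j1 j2] /andP[k1 k2] ijk.
have ij : `|i%:R - j%:R| * dl <= `|s - t| + dl.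
  apply: (@le_trans _ _ (`|k%:R - j%:R| * dl)).
    by rewrite ler_wpM2r// natr_dist_between.
  rewrite -[X in _ * X](ger0_norm dl_ge0) -normrM mulrBl.
  have -> : k%:R * dl - j%:R * dl =
      (s - t) + (k%:R * dl - j%:R * dl - (s - t)) by ring.
  apply: le_trans (ler_normD _ _) _; rewrite lerD2l ler_norml.
  by apply/andP; split; lra.
split=> //.
  move: ijk => /andP[_]; rewrite leq_max => /orP[]/ltnW; rewrite -(ler_nat R) => le_i.
    by apply: le_trans (ler_wpM2r dl_ge0 le_i) _; lra.
  by apply: le_trans (ler_wpM2r dl_ge0 le_i) _; lra.
have -> : a + i%:R * dl - t = (i%:R - j%:R) * dl + (j%:R * dl - (t - a)) by ring.
apply: le_trans (ler_normD _ _) _; rewrite normrM (ger0_norm dl_ge0).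
have : `|j%:R * dl - (t - a)| <= dl by rewrite ler_norml; apply/andP; split; lra.
by move: ij; lra.
Qed.

(** The elapsed grid time [w] differs from [s - t] by at most [dl]. Replacing one by the other in
    [euler_increment] costs the term [dl * (eta + |v|)], which vanishes with the step. *)
Lemma euler_near_linear (v : V) (eta s t : R) (j k : nat) : 0 <= eta ->
  j%:R * dl <= t - a < j%:R * dl + dl -> k%:R * dl <= s - a < k%:R * dl + dl ->
  (forall i, (minn j k <= i < maxn j k)%N ->
     `|g (a + i%:R * dl) (euler i) - v| <= eta) ->
  `|euler k - euler j - (s - t) *: v| <= eta * `|s - t| + dl * (eta + `|v|).
Proof.
move=> eta0 /andP[j1 j2] /andP[k1 k2] /euler_increment.
set w := (k%:R - j%:R) * dl.
have wst : `|w - (s - t)| <= dl.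
  by rewrite /w mulrBl ler_norml; apply/andP; split; lra.
have -> : `|k%:R - j%:R| * dl = `|w| by rewrite normrM (ger0_norm dl_ge0).
move=> le1.
have -> : euler k - euler j - (s - t) *: v =
    (euler k - euler j - w *: v) + (w - (s - t)) *: v.
  by rewrite [in RHS]scalerBl addrA subrK.
apply: le_trans (ler_normD _ _) _; rewrite normrZ.
have le2 : `|w - (s - t)| * `|v| <= dl * `|v| by rewrite ler_wpM2r.
have le3 : eta * `|w| <= eta * (`|s - t| + dl).
  rewrite ler_wpM2l// -[w](subrK (s - t)) addrC.
  by apply: le_trans (ler_normD _ _) _; rewrite lerD2l.
by move: le1 le2 le3; lra.
Qed.

End Euler.

(** The Euler polygons with step [h / n.+1] stay in a ball where [g] is bounded, so they have a
    pointwise ultralimit [z]. Near [t] all their slopes are close to [g t (z t)], and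
    [euler_near_linear] passes to the limit. *)
Theorem peano (R : realType) d (g : R -> 'rV[R]_d -> 'rV[R]_d) (a : R) q :
  continuous (fun p : R * 'rV[R]_d => g p.1 p.2) ->
  exists2 h : R, 0 < h & exists2 z : R -> 'rV[R]_d, z a = q &
    forall t, a <= t <= a + h -> deriv_on `[a, a + h] z t (g t (z t)).
Proof.
move=> cg; have [rho rho0 g_near] := joint_continuity a q cg ltr01.
pose M := `|g a q| + 1; have M1 : 1 <= M by rewrite lerDr.
(* From [h * (M + 1) = rho / 2], both the elapsed time and the distance travelled at speed [M] stay
   below [rho]. *)
pose h := rho / 2 / (M + 1).
have h0 : 0 < h by rewrite !divr_gt0//; lra.
have hM : h * (M + 1) = rho / 2 by rewrite divfK//; apply/eqP; lra.
have hM0 : 0 < h * M by rewrite mulr_gt0//; lra.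
exists h => //.
pose dl n := h / n.+1%:R.
have dl0 n : 0 < dl n by rewrite divr_gt0.
have le_dl n i j : (i <= j)%N -> i%:R * dl n <= j%:R * dl n.
  by move=> ij; rewrite ler_pM2r// ler_nat.
pose e n := euler g a q (dl n).
(* The bounds on slope and position feed each other: a position bound at node [i] controls the slope
   there, and the slope bound gives the position at node [i + 1]. *)
have g_bound n i : i%:R * dl n <= h -> `|e n i - q| <= M * (i%:R * dl n) ->
    `|g (a + i%:R * dl n) (e n i)| <= M.
  move=> ih le1; have i0 : 0 <= i%:R * dl n by rewrite mulr_ge0// ltW.
  have le3 : M * (i%:R * dl n) <= M * h by rewrite ler_wpM2l//; lra.
  rewrite -[g _ _](subrK (g a q)); apply: le_trans (ler_normD _ _) _.
  rewrite addrC lerD2l ltW//; apply: g_near; last by lra.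
  by rewrite addrC addrA addNr add0r ger0_norm//; lra.
have e_bound n i : i%:R * dl n <= h -> `|e n i - q| <= M * (i%:R * dl n).
  elim: i => [_|i IH ih]; first by rewrite subrr normr0 mul0r mulr0.
  have ilt : i%:R * dl n <= h by exact: le_trans (le_dl n _ _ (leqnSn i)) ih.
  have le1 := IH ilt; have le2 := g_bound n i ilt le1.
  rewrite /e /= -/(e n i) addrAC; apply: le_trans (ler_normD _ _) _.
  rewrite normrZ (gtr0_norm (dl0 n)) -natr1 [(_ + 1) * dl n]mulrDl mul1r.
  have : dl n * `|g (a + i%:R * dl n) (e n i)| <= dl n * M by rewrite ler_pM2l.
  by lra.
have e_lip n j k : j%:R * dl n <= h -> k%:R * dl n <= h ->
    `|e n k - e n j| <= M * (`|k%:R - j%:R| * dl n).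
  move=> jh kh; rewrite -[X in `|X|]subr0 -(scaler0 _ ((k%:R - j%:R) * dl n)).
  apply: euler_increment; first exact: ltW.
  move=> i /andP[_]; rewrite subr0 leq_max => ijk.
  suff ih : i%:R * dl n <= h by apply: g_bound => //; exact: e_bound.
  by case/orP: ijk => /ltnW/(le_dl n); lra.
have [U [UU subU]] := @ultraFilterLemma nat \oo _.
have U_dl e' : 0 < e' -> \forall n \near U, dl n < e'.
  move=> e'0; apply: subU.
  apply: filterS (nbhs_infty_ger (e'^-1 * h)) => n hn.
  rewrite /dl ltr_pdivrMr// -ltr_pdivrMl//.
  by apply: le_lt_trans hn _; rewrite ltr_nat.
(* [N n t] is the index of the last grid point not after [t]. *)
have [N N_itv] : {N : nat -> R -> nat & forall n t, a <= t ->
    (N n t)%:R * dl n <= t - a < (N n t)%:R * dl n + dl n}.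
  exists (fun n t => Num.truncn ((t - a) / dl n)) => n t at_.
  have /truncn_itv : 0 <= (t - a) / dl n by rewrite divr_ge0 ?subr_ge0// ltW.
  move: (Num.truncn _) => k.
  rewrite -[k.+1%:R]natr1 ler_pdivlMr// ltr_pdivrMr//.
  by rewrite [(_ + 1) * dl n]mulrDl mul1r.
(* No interpolation is needed: the jumps of X n vanish in the limit. *)
pose X n t := e n (N n t).
have [z Xz] : {z : R -> 'rV[R]_d &
    forall t, a <= t <= a + h -> X n t @[n --> U] --> z t}.
  apply: (@choice _ _ (fun t l => a <= t <= a + h -> X n t @[n --> U] --> l)) => t.
  have [/andP[at_ th]|_] := boolP (a <= t <= a + h); last by exists 0.
  have [|l Xl] := @ultra_cvg_bounded R nat U UU d (X ^~ t) (`|q| + M * h).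
    apply: filterE => n; have := N_itv n t at_ => /andP[N1 _].
    have Nh : (N n t)%:R * dl n <= h by lra.
    rewrite -[X n t](subrK q) addrC; apply: le_trans (ler_normD _ _) _.
    rewrite lerD2l; apply: le_trans (e_bound _ _ Nh) _.
    by rewrite ler_wpM2l//; lra.
  by exists l.
exists z.
  have Xa : X n a @[n --> U] --> z a by apply: Xz; lra.
  apply/eqP; rewrite -subr_eq0 -normr_le0.
  apply: (ultra_cvg_dist_le Xa) => e' e'0; apply: filterE => n.
  have /andP[Na _] := N_itv n a (lexx a).
  have -> : X n a = q.
    rewrite /X; case: (N n a) Na => // k; rewrite subrr pmulr_lle0//.
    by rewrite lern0.
  by rewrite subrr normr0; lra.
move=> t tah eta eta0; have /andP[at_ th] := tah.
have [r r0 g_eta] := joint_continuity t (z t) cg eta0.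
(* Since [M >= 1], times within [3 * r'] are within [r]. In space, the grid values move by at most
   [M * (2 * r') = r / 2] from [X n t], which is itself within [r' <= r / 4] of [z t]. *)
pose r' := r / 4 / M.
have rM : r' * M = r / 4 by rewrite divfK//; apply/eqP; lra.
have r'0 : 0 < r' by rewrite !divr_gt0//; lra.
have r'M : r' <= r' * M by rewrite ler_pMr.
exists r' => // s /=; rewrite in_itv /= => /[dup] sah /andP[as_ sh] st.
have XB : X n s - X n t @[n --> U] --> z s - z t by apply: cvgB; exact: Xz.
apply: (ultra_cvg_dist_le XB) => e' e'0.
have v0 : 0 < eta + `|g t (z t)| by rewrite ltr_wpDr.
have near1 := U_dl _ (divr_gt0 e'0 v0).
have near2 := U_dl _ r'0.
have near3 : \forall n \near U, `|z t - X n t| < r'.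
  by move/cvgrPdist_lt: (Xz t tah); apply.
near=> n.
have dn1 : dl n < e' / (eta + `|g t (z t)|) by near: n.
have dn2 : dl n < r' by near: n.
have Xn : `|z t - X n t| < r' by near: n.
have /andP[Ns1 Ns2] := N_itv n s as_; have /andP[Nt1 Nt2] := N_itv n t at_.
apply: le_trans (euler_near_linear (ltW (dl0 n)) (ltW eta0) (N_itv n t at_)
  (N_itv n s as_) (v := g t (z t)) _) _; last first.
  by rewrite lerD2l -ler_pdivlMr// ltW.
have th' : t - a <= h by rewrite lerBlDl.
have sh' : s - a <= h by rewrite lerBlDl.
move=> i ist.
have [ih ij it] := grid_between (ltW (dl0 n)) th' sh' (N_itv n t at_)
  (N_itv n s as_) ist.
have Nh : (N n t)%:R * dl n <= h.
  by apply: le_trans th'; case/andP: (N_itv n t at_).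
have ij2 : `|i%:R - (N n t)%:R| * dl n <= 2 * r'.
  by apply: le_trans ij _; rewrite mulr_natl lerD// ltW.
have r4 : 4 * r' <= r by rewrite mulrC -ler_pdivlMr// -rM.
apply/ltW/g_eta.
  apply: le_lt_trans it _; apply: lt_le_trans r4.
  by move: r'0 st dn2; clear; lra.
have le2 := e_lip n _ _ Nh ih.
rewrite -[euler _ _ _ _ _](subrK (X n t)) -addrA.
apply: le_lt_trans (ler_normD _ _) _.
rewrite [`|X n t - _|]distrC.
have le3 : M * (`|i%:R - (N n t)%:R| * dl n) <= M * (2 * r').
  by rewrite ler_wpM2l// (le_trans ler01).
by move: r0 le2 le3 Xn r'M rM; rewrite -/(X n t) -/(e n) [r' * M]mulrC; clear; lra.
Unshelve. all: by end_near.
Qed.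

Lemma joint_bounded (R : realType) d (g : R -> 'rV[R]_d -> 'rV[R]_d) (T B : R) :
  continuous (fun p : R * 'rV[R]_d => g p.1 p.2) ->
  exists2 M : R, 0 < M & forall t u, 0 <= t <= T -> `|u| <= B -> `|g t u| <= M.
Proof.
move=> cg; pose G (p : R * 'rV[R]_d) := g p.1 p.2.
have cK := compact_setX (@segment_compact R 0 T) (@compact_norm_le R d B).
have /compact_bounded [M [_ GM]] :=
  continuous_compact (continuous_subspaceT (f := G) cg) cK.
exists (`|M| + 1) => [|t u tT uB]; first by rewrite ltr_wpDl.
apply: GM; last by exists (t, u) => //; split => //=; rewrite in_itv.
by rewrite (le_lt_trans (ler_norm M))// ltrDl.
Qed.

Section Escape.
Context {R : realType} {d : nat} (g : R -> 'rV[R]_d -> 'rV[R]_d).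
Hypothesis cg : continuous (fun p : R * 'rV[R]_d => g p.1 p.2).
Variables (x0 : 'rV[R]_d) (I : set R) (x : R -> 'rV[R]_d).
Hypothesis xmax : maximal_solution g x0 I x.

Lemma maximal_no_extension (I' : set R) (x' : R -> 'rV[R]_d) :
  I `<=` I' -> (forall t, I t -> x' t = x t) ->
  is_interval I' -> (forall t, I' t -> 0 <= t) ->
  (forall t, I' t -> deriv_on I' x' t (g t (x' t))) -> I' = I.
Proof.
move=> II' x'x itv' I'0 dx'.
have [[[_ I0 _ [t t0 It]] xx0 _] xM] := xmax.
apply: (xM I' x'); last by split => // r Ir; rewrite x'x.
split; [split => //|by rewrite x'x|by move=> r I'r; apply/has_deriv_withinP/dx'].
- exact: II'.
- by exists t => //; exact: II'.
Qed.

(** Otherwise [om = sup I] is finite. If [om] lies in [I], Peano's theorem continues the solution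
    beyond it. If not, boundedness of [g] makes [x] Lipschitz near [om], so [x] has a limit there
    and [om] can be added to [I]. Both contradict maximality. *)
Lemma maximal_solution_escapes (t0 T B : R) : I t0 ->
  ~ (forall r, I r -> t0 <= r -> r <= T /\ `|x r| <= B).
Proof.
move=> It0 xB.
have [[[itvI I0 Ige0 _] _ dx'] _] := xmax.
have dx t : I t -> deriv_on I x t (g t (x t)) by move=> /dx' /has_deriv_withinP.
have supI : has_sup I.
  split; first by exists 0.
  exists (Order.max T t0) => r Ir; rewrite le_max.
  by have [/(xB r Ir)[->//]|/ltW->] := leP t0 r; rewrite orbT.
have [om Ile lt_omI] : exists2 om, forall r, I r -> r <= om &
    forall r, 0 <= r < om -> I r.
  exists (sup I) => [|r /andP[r0 rom]]; first exact: sup_upper_bound.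
  have rom0 : 0 < sup I - r by lra.
  have [s Is oms] := sup_adherent rom0 supI.
  by apply: (itvI 0 s) => //; lra.
have om0 : 0 <= om by exact: Ile.
have [Iom|nIom] := pselect (I om).
  have [h h0 [z zom dz]] := peano om (x om) cg.
  pose x' r := if r <= om then x r else z r.
  have x'z r : om <= r -> x' r = z r.
    move=> omr; rewrite /x'; case: leP => // rom.
    by rewrite (@le_anti _ _ r om) ?zom// rom.
  have x'x r : r <= om -> x' r = x r by rewrite /x' => ->.
  have itvh r : `[om, om + h]%classic r <-> om <= r <= om + h by rewrite /= in_itv.
  have I'E : I `|` `[om, om + h]%classic = I.
    apply: (@maximal_no_extension _ x').
    - exact: subsetUl.
    - by move=> t /Ile; exact: x'x.
    - move=> r s Ir Is u /andP[ru us]; have [uom|omu] := leP u om; [left|right].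
        case: Ir => [Ir|/itvh romh]; first by apply: (itvI r om) => //; lra.
        by have -> : u = om by apply/le_anti; lra.
      by apply/itvh; case: Is => [/Ile som|/itvh]; lra.
    - by move=> t [/Ige0//|/itvh]; lra.
    - have dI t : I t -> deriv_on I x' t (g t (x t)).
        move=> It; apply: deriv_on_local (dx _ It); first by rewrite x'x ?Ile.
        by exists 1 => // s Is _; rewrite x'x ?Ile.
      have dh t : om <= t <= om + h -> deriv_on `[om, om + h] x' t (g t (z t)).
        move=> th; apply: deriv_on_local (dz _ th); first by rewrite x'z//; lra.
        by exists 1 => // s /[dup] /itvh sh hs _; rewrite x'z//; lra.
      (* Away from [om], a small radius meets only one of the two pieces. At [om] the one-sided
         derivatives agree because [z om = x om]. *)
      move=> t I't; have [tom|omt|tom] := ltgtP t om.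
      + have It : I t by case: I't => // /itvh; lra.
        rewrite x'x ?Ile//; apply: deriv_on_local (dI _ It) => //.
        exists (om - t) => [|s]; first by lra.
        by rewrite ltr_norml => -[Is _|/itvh ? ?]; [split|exfalso; lra].
      + have th : om <= t <= om + h by case: I't => [/Ile|/itvh]; lra.
        rewrite x'z ?ltW//; apply: deriv_on_local (dh _ th) => //.
        exists (t - om) => [|s]; first by lra.
        by rewrite ltr_norml => -[/Ile ? ?|hs _]; [exfalso; lra|split].
      + rewrite tom x'x//; apply: deriv_on_setU; first exact: dI.
        by rewrite -zom; apply: dh; lra.
  have : I (om + h) by rewrite -I'E; right; apply/itvh; lra.
  by move/Ile; lra.
have ltom r : I r -> r < om.
  move=> Ir; rewrite lt_neqAle Ile// andbT; apply/eqP => rE.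
  by apply: nIom; rewrite -rE.
have Ige r : I r -> 0 <= r by exact: Ige0.
have t0om := ltom _ It0; have t00 := Ige _ It0.
have [M M0 gM] := joint_bounded om B cg.
(* The limit of [x] at [om] is taken along an ultrafilter of left neighbourhoods of [om]. *)
have [U [UU subU]] := @ultraFilterLemma R (om^'-) _.
have itvA c : is_interval [set r | I r /\ c <= r].
  move=> r s [Ir cr] [Is cs] u /andP[ru us]; split; last by lra.
  by apply: (itvI r s) => //; lra.
have xlip r s : I r -> I s -> t0 <= r -> t0 <= s -> `|x r - x s| <= M * `|r - s|.
  move=> Ir Is r0 s0.
  (* Comparison with [r *: 0], the line of slope 0, turns the mean value inequality into a Lipschitz
     bound. *)
  have := @mean_value_dist R _ [set r | I r /\ t0 <= r] x (fun r => r *: 0)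
            (fun t => g t (x t)) (fun=> 0) M r s.
  rewrite !scaler0 subr0 subr0; apply => //.
  - by move=> c [Ic _]; apply: sub_deriv_on (dx c Ic) => u [].
  - by move=> c _; exact: deriv_on_line.
  - move=> c [Ic t0c]; rewrite subr0; apply: gM; first by rewrite Ige// Ile.
    by have [] := xB c Ic t0c.
have nearU c : c < om -> \forall r \near U, c < r < om.
  move=> com; apply: subU; near=> r.
  by apply/andP; split; near: r; [exact: nbhs_left_gt|exact: nbhs_left_lt].
have [|q xq] := @ultra_cvg_bounded R R U UU d x B.
  apply: filterS (nearU _ t0om) => r rt.
  have Ir : I r by apply: lt_omI; lra.
  by have [] := xB r Ir (ltac:(lra)).
have xdist s : I s -> t0 <= s -> `|q - x s| <= M * (om - s).
  move=> Is ts; apply: (ultra_cvg_dist_le xq) => e e0.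
  have som := ltom _ Is; have s0 := Ige _ Is.
  apply: filterS (nearU _ som) => r sr.
  have Ir : I r by apply: lt_omI; lra.
  apply: le_trans (xlip _ _ Ir Is _ ts) _; first by lra.
  rewrite ger0_norm ?subr_ge0; last by lra.
  have : M * (r - s) <= M * (om - s) by rewrite ler_pM2l//; lra.
  by lra.
pose x' r := if r == om then q else x r.
have x'x r : I r -> x' r = x r by move=> /ltom rom; rewrite /x' lt_eqF.
have x'om : x' om = q by rewrite /x' eqxx.
have I'E : I `|` [set om] = I.
  apply: (@maximal_no_extension _ x').
  - exact: subsetUl.
  - exact: x'x.
  - move=> r s Ir Is u /andP[ru us].
    have som : s <= om by case: Is => [/Ile//|->].
    have r0 : 0 <= r by case: Ir => [/Ige//|->].
    have [uom|omu] := ltP u om; first by left; apply: lt_omI; lra.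
    by right; apply: le_anti; lra.
  - by move=> t [/Ige//|->].
  - move=> t [It|->].
      have tom := ltom _ It.
      rewrite x'x//; apply: deriv_on_local (dx _ It); first by rewrite x'x.
      exists (om - t) => [|s]; first by lra.
      move=> [Is|-> ]; first by rewrite x'x.
      by rewrite ltr_norml => ?; exfalso; lra.
    rewrite x'om => eta eta0; have [r0 r00 gr0] := joint_continuity om q cg eta0.
    (* The bound [r0] controls time, [r0 / M] keeps [x] within [r0] of [q] by [xdist], and [om - t0]
       ensures that [s] lies after [t0]. *)
    exists (Order.min (Order.min r0 (r0 / M)) (om - t0)).
      by rewrite !lt_min r00 divr_gt0//=; lra.
    move=> s [Is|->]; last by rewrite x'om !subrr scale0r subr0 !normr0 mulr0.
    have som := ltom _ Is; have s0 := Ige _ Is.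
    rewrite distrC gtr0_norm ?subr_gt0// !lt_min => /andP[/andP[sr0 sr1] sr2].
    rewrite x'x // x'om.
    set v := g om q in gr0 *.
    (* The estimate at [om] is the limit, as [r] tends to [om], of the comparison of [x] on [[s, r]]
       with the line of slope [v]. *)
    have xU : (fun r => x r - r *: v) @ U --> q - om *: v.
      apply: cvgB => //; apply: cvgZl => W Wom.
      by apply: subU; exact: cvg_at_left_filter Wom.
    have -> : x s - q - (s - om) *: v = - ((q - om *: v) - (x s - s *: v)).
      by rewrite opprB subrACA scalerBl.
    rewrite normrN; apply: (ultra_cvg_dist_le xU) => e e0.
    apply: filterS (nearU _ som) => r sr.
    have Ir : I r by apply: lt_omI; lra.
    rewrite subrACA.
    have : `|x r - x s - (r *: v - s *: v)| <= eta * `|r - s|.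
      apply: (@mean_value_dist R _ [set r | I r /\ s <= r] x (fun r => r *: v)
            (fun t => g t (x t)) (fun=> v)) => //.
      + by split => //; lra.
      + by move=> c [Ic _]; apply: sub_deriv_on (dx c Ic) => u [].
      + by move=> c _; exact: deriv_on_line.
      + move=> c [Ic sc]; have cle := Ile _ Ic; apply/ltW/gr0.
          by rewrite ltr_norml; lra.
        rewrite distrC; apply: le_lt_trans (xdist c Ic _) _; first by lra.
        by rewrite mulrC -ltr_pdivlMr//; lra.
    rewrite ger0_norm ?subr_ge0; last by lra.
    have : eta * (r - s) <= eta * (om - s) by rewrite ler_pM2l//; lra.
    by lra.
by apply: nIom; rewrite -I'E; right.
Unshelve. all: by end_near.
Qed.

End Escape.

(** * Time averages *)

Lemma rV_norm_le (R : realType) d (v : 'rV[R]_d) (k : R) : 0 <= k ->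
  (forall i, `|v 0 i| <= k) -> `|v| <= k.
Proof.
move=> k0 vk; rewrite [leLHS]/Num.Def.normr /= mx_normrE.
by apply/bigmax_leP; split => // -[i j] _ /=; rewrite ord1.
Qed.

Lemma rV_coord_le_norm (R : realType) d (v : 'rV[R]_d) i : `|v 0 i| <= `|v|.
Proof.
rewrite [leRHS]/Num.Def.normr /= mx_normrE; apply/bigmax_geP; right => /=.
by exists (0, i).
Qed.

Lemma continuous_Rintegral_primitive (R : realType) (g : R -> R) :
  continuous g ->
  exists H : R -> R, H 0 = 0 /\
    (forall t : R, 0 <= t -> forall eta : R, 0 < eta ->
       \forall s \near t, `|H s - H t - (s - t) * g t| <= eta * `|s - t|) /\
    forall T, 0 < T -> \int[lebesgue_measure]_(t in `[0, T]) g t = H T.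
Proof.
move=> cg; have gint (a b : R) :
    (lebesgue_measure : measure _ R).-integrable `[a, b] (EFin \o g).
  apply: continuous_compact_integrable; first exact: segment_compact.
  exact: continuous_subspaceT.
(* Integrating from -1 makes 0 an interior point, so the fundamental theorem of calculus applies
   there too. Subtracting [H 0] restores the base point 0. *)
pose H x := \int[lebesgue_measure]_(t in `[-1, x]) g t.
exists (fun x => H x - H 0); split; first by rewrite subrr.
split=> [t t0 eta eta0|T T0].
  have [|||] := @continuous_FTC1_closed R g (-1) t (t + 1) _ (gint _ _).
  - by rewrite ltrDl.
  - by rewrite (lt_le_trans _ t0)// ltrN10.
  - exact: cg.
  rewrite -/H => dH; rewrite /derive1.
  have -> : (fun h => h^-1 *: (H (h + t) - H t)) =
      (fun h : R => h^-1 *: ((H \o shift t) (h *: 1) - H t)).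
    by apply/funext => h /=; rewrite [h%:A]mulr1.
  move=> gt; move: dH; rewrite /derivable => /cvgrPdist_le /(_ _ eta0).
  rewrite gt => -[rho /= rho0 Hrho]; exists rho => // s /= st.
  have -> : H s - H 0 - (H t - H 0) = H s - H t by lra.
  have [->|sNt] := eqVneq s t; first by rewrite !subrr mul0r subrr normr0 mulr0.
  have sNt0 : s - t != 0 by rewrite subr_eq0.
  have le1 : `|g t - (s - t)^-1 *: (H s - H t)| <= eta.
    have := Hrho (s - t); rewrite /= [(s - t)%:A]mulr1 subrK; apply => //.
    by rewrite sub0r opprB.
  have -> : H s - H t - (s - t) * g t =
      - ((s - t) * (g t - (s - t)^-1 * (H s - H t))).
    by field.
  by rewrite normrN normrM mulrC ler_wpM2r.
have ->: H T - H 0 = \int[lebesgue_measure]_(t in `]0, T]) g t.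
  by apply: Rintegral_itvB; rewrite ?bnd_simp ?lerN10 ?ltW.
rewrite Rintegral_itv_obnd_cbnd//.
by apply: integrableS (gint 0 T) => //; exact: subset_itv_oc_cc.
Qed.

Lemma primitive_row (R : realType) d (g : R -> 'rV[R]_d) : continuous g ->
  exists G : R -> 'rV[R]_d, G 0 = 0 /\
    (forall t, 0 <= t -> deriv_on [set s | 0 <= s] G t (g t)) /\
    forall T, 0 < T ->
      \row_(i < d) \int[lebesgue_measure]_(t in `[0, T]) g t 0 i = G T.
Proof.
move=> cg.
have /choice [H HP] : forall i : 'I_d, exists H : R -> R, H 0 = 0 /\
    (forall t : R, 0 <= t -> forall eta : R, 0 < eta ->
       \forall s \near t, `|H s - H t - (s - t) * g t 0 i| <= eta * `|s - t|) /\
    forall T, 0 < T -> \int[lebesgue_measure]_(t in `[0, T]) g t 0 i = H T.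
  move=> i; apply: continuous_Rintegral_primitive => t.
  exact: (continuous_comp (cg t) (@coord_continuous R 1 d 0 i _)).
exists (fun T => \row_i H i T); split; first by apply/rowP => i; rewrite !mxE (HP i).1.
split=> [t t0 eta eta0|T T0]; last first.
  by apply/rowP => i; rewrite !mxE (HP i).2.2.
have := @filter_forall R 'I_d _ (nbhs t) _ (fun i => (HP i).2.1 t t0 eta eta0).
case=> rho /= rho0 Hrho; exists rho => // s _ st.
apply: rV_norm_le => [|i]; first by rewrite mulr_ge0// ltW.
by rewrite !mxE; apply: Hrho; rewrite /= distrC.
Qed.

(** The factor [eps] in front cancels the [1 / eps] of the chain rule, so the slope is unchanged
    while values shrink. *)
Lemma deriv_on_rescale (R : realType) (V : normedModType R) (G : R -> V)
    (eps t : R) v : 0 < eps ->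
  deriv_on [set s | 0 <= s] G (t / eps) v ->
  deriv_on [set s | 0 <= s] (fun s => eps *: G (s / eps)) t v.
Proof.
move=> eps0 dG eta eta0; have [rho rho0 Grho] := dG eta eta0.
exists (rho * eps) => [|s /= s0 st]; first by rewrite mulr_gt0.
have E : s / eps - t / eps = (s - t) / eps by rewrite mulrBl.
have st' : `|s / eps - t / eps| < rho.
  by rewrite E normrM (gtr0_norm (x := eps^-1)) ?invr_gt0// ltr_pdivrMr.
have := Grho _ (divr_ge0 s0 (ltW eps0)) st'; rewrite E => le1.
have -> : eps *: G (s / eps) - eps *: G (t / eps) - (s - t) *: v =
    eps *: (G (s / eps) - G (t / eps) - ((s - t) / eps) *: v).
  by rewrite !scalerBr scalerA [eps * _]mulrC divfK ?gt_eqF.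
rewrite normrZ (gtr0_norm eps0) mulrC -ler_pdivlMr//; apply: le_trans le1 _.
by rewrite normrM (gtr0_norm (x := eps^-1)) ?invr_gt0// mulrA.
Qed.

(* f(., p) may be unbounded in time, but the primitive Phi absorbs it. *)
Lemma averaged_drift (R : realType) d (f : R -> 'rV[R]_d -> 'rV[R]_d) p :
  continuous (fun q : R * 'rV[R]_d => f q.1 q.2) ->
  cvg (time_average f p @ +oo) ->
  forall T e : R, 0 < T -> 0 < e ->
  exists2 eps0 : R, 0 < eps0 & forall eps, 0 < eps -> eps <= eps0 ->
    exists2 Phi : R -> 'rV[R]_d,
      forall t, 0 <= t -> deriv_on [set s | 0 <= s] Phi t (f (t / eps) p) &
      forall r, 0 <= r <= T -> `|Phi r - r *: averaged f p| <= e.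
Proof.
move=> cf cvgf T e T0 e0; set F := averaged f p.
have cfp : continuous (f ^~ p).
  move=> t; apply: (@continuous_comp _ _ _ (fun s => (s, p)) (fun q => f q.1 q.2)).
    exact: (cvg_pair (f := id) (g := fun=> p) cvg_id (cvg_cst p)).
  exact: cf.
have [G [G0 [dG intG]]] := primitive_row cfp.
have eT0 : 0 < e / T by rewrite divr_gt0.
move/cvgrPdist_le : (cvgf) => /(_ _ eT0) [T1 [_ T1P]].
(* Strictly beyond [T1] and positive: past [T2] the time average is within [e / T] of its limit. *)
pose T2 := Order.max T1 0 + 1.
have T21 : T1 < T2 by rewrite /T2 ltr_pwDr// le_max lexx.
have T20 : 0 < T2 by rewrite /T2 ltr_wpDl// le_max lexx orbT.
have Gfar s : T2 <= s -> `|G s - s *: F| <= s * (e / T).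
  move=> T2s; have s0 : 0 < s by exact: lt_le_trans T2s.
  have := T1P s (lt_le_trans T21 T2s).
  rewrite /time_average intG// -/(averaged f p) -/F => le1.
  have -> : G s - s *: F = - (s *: (F - s^-1 *: G s)).
    by rewrite scalerBr scalerA divff ?gt_eqF// scale1r opprB.
  by rewrite normrN normrZ gtr0_norm// ler_pM2l.
have [M M0 fM] := joint_bounded T2 `|p| cf.
(* On [[0, T2]] the average says nothing, but the deviation is at most a constant [B], which the
   factor [eps] makes small. *)
pose B := (M + `|F|) * T2.
have MF0 : 0 <= M + `|F| by rewrite addr_ge0// ltW.
have B0 : 0 <= B by exact: mulr_ge0 MF0 (ltW T20).
have Gnear s : 0 <= s <= T2 -> `|G s - s *: F| <= B.
  move=> /andP[s0 sT2].
  have := @mean_value_dist R _ `[0, T2] G (fun r => r *: F) (f ^~ p) (fun=> F)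
      (M + `|F|) s 0.
  rewrite G0 scale0r !subr0 => le1; apply: (@le_trans _ _ ((M + `|F|) * `|s|)).
    apply: le1.
    - exact: interval_is_interval.
    - by rewrite /= in_itv /= s0.
    - by rewrite /= in_itv /= lexx ltW.
    - move=> c /=; rewrite in_itv /= => /andP[c0 _].
      by apply: sub_deriv_on (dG _ c0) => u /=; rewrite in_itv => /andP[].
    - by move=> c _; exact: deriv_on_line.
    - move=> c /=; rewrite in_itv /= => c0.
      by apply: le_trans (ler_normB _ _) _; rewrite lerD2r; apply: fM.
  by rewrite ger0_norm// ler_wpM2l// addr_ge0// ltW.
(* Early times give [eps * B <= e]. Late times give [eps * (r / eps) * (e / T) <= e], for every
   [eps]. *)
exists (e / (B + 1)) => [|eps eps0 epsle]; first by rewrite divr_gt0// ltr_wpDl.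
exists (fun r => eps *: G (r / eps)) => [t t0|r /andP[r0 rT]].
  by apply: deriv_on_rescale => //; apply: dG; rewrite divr_ge0// ltW.
have -> : eps *: G (r / eps) - r *: F = eps *: (G (r / eps) - (r / eps) *: F).
  by rewrite scalerBr scalerA [eps * _]mulrC divfK ?gt_eqF.
rewrite normrZ gtr0_norm//.
have [near|far] := leP (r / eps) T2.
  have le1 : `|G (r / eps) - (r / eps) *: F| <= B.
    by apply: Gnear; rewrite near andbT divr_ge0// ltW.
  apply: (@le_trans _ _ (eps * (B + 1))); last by rewrite -ler_pdivlMr// ltr_wpDl.
  by rewrite ler_pM2l//; lra.
have le1 := Gfar _ (ltW far).
apply: (@le_trans _ _ (eps * (r / eps * (e / T)))); first by rewrite ler_pM2l.
rewrite mulrA [eps * _]mulrC divfK ?gt_eqF// mulrA ler_pdivrMr//.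
by rewrite mulrC ler_pM2l.
Qed.

(** * Ultralimits of solutions of the fast equation *)

Lemma continuous_map_fst (S T V : topologicalType) (phi : S -> T) :
  continuous phi -> continuous (fun p : S * V => (phi p.1, p.2)).
Proof.
move=> cphi p.
have c1 : (fun q : S * V => phi q.1) @ p --> phi p.1.
  apply: (cvg_comp (fst : S * V -> S) phi _ (cphi p.1)).
  by case: p => a b; exact: cvg_fst.
have c2 : (snd : S * V -> V) @ p --> p.2.
  by case: p {c1} => a b; exact: cvg_snd.
exact: (cvg_pair c1 c2).
Qed.

Lemma continuous_reparam (R : realType) d (f : R -> 'rV[R]_d -> 'rV[R]_d)
    (phi : R -> R) : continuous phi ->
  continuous (fun p : R * 'rV[R]_d => f p.1 p.2) ->
  continuous (fun p : R * 'rV[R]_d => f (phi p.1) p.2).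
Proof.
move=> cphi cf p.
have cq : {for p, continuous (fun q : R * 'rV[R]_d => (phi q.1, q.2))}.
  exact: continuous_map_fst.
exact: (continuous_comp cq (cf (phi p.1, p.2))).
Qed.

(** A trapping argument: as long as the curve is within [k] of [p], it is in fact within [m < k], so
    by continuity it can never reach distance [k]. *)
Lemma no_escape (R : realType) (V : normedModType R) (w : R -> V) p (a b k m : R) :
  m < k -> `|w a - p| < k ->
  (forall r, a <= r <= b -> forall e : R, 0 < e -> exists2 rho : R, 0 < rho &
     forall s, a <= s <= b -> `|s - r| < rho -> `|w s - w r| < e) ->
  (forall s, a <= s <= b -> (forall u, a <= u <= s -> `|w u - p| < k) ->
     `|w s - p| <= m) ->
  forall c, a <= c <= b -> `|w c - p| < k.
Proof.
move=> mk wa w_cont w_m; apply: (@real_induction _ (fun r => `|w r - p| < k)) => //.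
  move=> r /andP[ar rb] wr.
  have xrp : 0 < k - `|w r - p| by rewrite subr_gt0 wr// ar lexx.
  have [|rho rho0 H] := w_cont r _ _ xrp; first by lra.
  exists (Order.min (r + rho / 2) b); first by rewrite lt_min rb andbT; lra.
  move=> s; rewrite le_min => /and3P[rs s1 s2].
  rewrite -(subrK (w r) (w s)) -addrA.
  apply: le_lt_trans (ler_normD _ _) _; rewrite -ltrBrDr; apply: H; first by lra.
  by rewrite ger0_norm; lra.
move=> r /andP[ar rb] wr.
have km0 : 0 < k - m by lra.
have [|rho rho0 H] := w_cont r _ _ km0; first by lra.
pose s := Order.max a (r - rho / 2).
have as_ : a <= s by rewrite le_max lexx.
have sr : s < r by rewrite gt_max ar /=; lra.
have rs : r - rho / 2 <= s by rewrite le_max lexx orbT.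
have le1 : `|w s - w r| < k - m by apply: H; [lra|rewrite ltr0_norm; lra].
have le2 : `|w s - p| <= m by apply: w_m => [|u us]; [lra|apply: wr; lra].
rewrite -(subrK (w s) (w r)) -addrA; apply: le_lt_trans (ler_normD _ _) _.
by rewrite distrC; lra.
Qed.

(** Two points on different sides are joined through [b], which incurs the error [e] twice. *)
Lemma lipschitz_glue (R : realType) (V : normedModType R) (w : R -> V)
    (a b c C K e : R) : 0 <= C -> 0 <= K -> 0 <= e -> a <= b <= c ->
  (forall r s, a <= r <= b -> a <= s <= b -> `|w r - w s| <= C * `|r - s| + e) ->
  (forall r s, b <= r <= c -> b <= s <= c -> `|w r - w s| <= K * `|r - s| + e) ->
  forall r s, a <= r <= c -> a <= s <= c ->
    `|w r - w s| <= (C + K) * `|r - s| + 2 * e.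
Proof.
move=> C0 K0 e0 /andP[ab bc] wC wK.
have across r s : a <= r <= b -> b <= s <= c ->
    `|w r - w s| <= (C + K) * `|r - s| + 2 * e.
  move=> /andP[ar rb] /andP[bs sc].
  have le1 : `|w r - w b| <= C * (b - r) + e.
    by rewrite -(ger0_norm (x := b - r)) ?subr_ge0// (distrC b); apply: wC; lra.
  have le2 : `|w b - w s| <= K * (s - b) + e.
    by rewrite -(ger0_norm (x := s - b)) ?subr_ge0// (distrC s); apply: wK; lra.
  rewrite -(subrK (w b) (w r)) -addrA; apply: le_trans (ler_normD _ _) _.
  rewrite (distrC r) ger0_norm ?subr_ge0 ?(le_trans rb)//.
  have : C * (b - r) <= C * (s - r) by rewrite ler_wpM2l// lerD2r.
  have : K * (s - b) <= K * (s - r) by rewrite ler_wpM2l// lerD2l lerN2.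
  by lra.
move=> r s /andP[ar rc] /andP[as_ sc].
have Cn : 0 <= C * `|r - s| by rewrite mulr_ge0.
have Kn : 0 <= K * `|r - s| by rewrite mulr_ge0.
have [rb|/ltW br] := leP r b; have [sb|/ltW bs] := leP s b.
- by have := wC r s; rewrite ar rb as_ sb => /(_ isT isT); lra.
- by apply: across; rewrite ?ar ?rb ?bs ?sc.
- by rewrite distrC (distrC r); apply: across; rewrite ?as_ ?sb ?br ?rc.
- by have := wK r s; rewrite br rc bs sc => /(_ isT isT); lra.
Qed.

Section UltraLimitOfSolutions.
Context {R : realType} {d : nat} (f : R -> 'rV[R]_d -> 'rV[R]_d).
Hypothesis f_cont : continuous (fun p : R * 'rV[R]_d => f p.1 p.2).
Hypothesis f_equicont : forall (p : 'rV[R]_d) (eta : R), 0 < eta ->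
  exists2 kappa : R, 0 < kappa & forall t u, 0 <= t -> `|u - p| < kappa ->
    `|f t u - f t p| < eta.
Hypothesis f_avg : forall p, cvg (time_average f p @ +oo).

Context {T : Type} (U : set_system T) {UU : UltraFilter U}.
Variables (x0 : 'rV[R]_d) (eps : T -> R) (I : T -> set R) (x : T -> R -> 'rV[R]_d).
Hypothesis eps_gt0 : forall n, 0 < eps n.
Hypothesis eps_cvg0 : forall e : R, 0 < e -> \forall n \near U, eps n <= e.
Hypothesis x_max : forall n,
  maximal_solution (fun t u => f (t / eps n) u) x0 (I n) (x n).
Variable L : R.
Hypothesis L_ge0 : 0 <= L.

Lemma x_itv n : is_interval (I n).
Proof. by have [[[]]] := x_max n. Qed.

Lemma x_init n : I n 0 /\ x n 0 = x0.
Proof. by have [[[]]] := x_max n. Qed.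

Lemma x_deriv n t : I n t -> deriv_on (I n) (x n) t (f (t / eps n) (x n t)).
Proof.
move=> It; apply/has_deriv_withinP; have [[_ _ dx] _] := x_max n; exact: dx.
Qed.

(** Compare [x n] with the primitive [Phi] of [f (t / eps n) p]: [mean_value_dist] gives the term in
    [eta], and [Phi] is within [e / 2] of linear motion at either end. The set [A] is quantified
    after the index, so one set of indices serves all [A], even those depending on [n]. *)
Lemma drift_near (p : 'rV[R]_d) (eta e : R) : 0 < e ->
  \forall n \near U, forall A : set R, is_interval A -> A `<=` I n ->
    (forall c, A c -> 0 <= c <= L + 1 /\
       `|f (c / eps n) (x n c) - f (c / eps n) p| <= eta) ->
    forall s t, A s -> A t ->
      `|x n s - x n t - (s - t) *: averaged f p| <= eta * `|s - t| + e.
Proof.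
move=> e0; have e20 : 0 < e / 2 by lra.
have L1 : 0 < L + 1 by rewrite ltr_wpDl.
have [e1 e10 drift] := averaged_drift f_cont (@f_avg p) L1 e20.
apply: filterS (eps_cvg0 e10) => n epsn A itvA AI Anear s t As At.
have [Phi dPhi PhiF] := drift _ (eps_gt0 n) epsn.
have le1 := PhiF s (Anear s As).1; have le2 := PhiF t (Anear t At).1.
have le3 : `|x n s - x n t - (Phi s - Phi t)| <= eta * `|s - t|.
  apply: (mean_value_dist (x' := fun c => f (c / eps n) (x n c))
            (y' := fun c => f (c / eps n) p) itvA As At).
  - by move=> c Ac; apply: sub_deriv_on (x_deriv (AI c Ac)).
  - move=> c Ac; have [/andP[c0 _] _] := Anear c Ac.
    by apply: sub_deriv_on (dPhi c c0) => u /Anear[/andP[]].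
  - by move=> c /Anear[].
have -> : x n s - x n t - (s - t) *: averaged f p =
  (x n s - x n t - (Phi s - Phi t)) +
  ((Phi s - s *: averaged f p) - (Phi t - t *: averaged f p)).
  by rewrite (subrACA (Phi s)) addrA subrK scalerBl.
apply: le_trans (ler_normD _ _) _.
have := ler_normB (Phi s - s *: averaged f p) (Phi t - t *: averaged f p).
by lra.
Qed.

(** The constant [C] is chosen before [e], so the limit is Lipschitz, although [f] unbounded in time
    allows no uniform Lipschitz constant for the [x n] themselves. Existence on [[0, tau]] is part
    of the property, so that one real induction yields both. *)
Definition asymp_lipschitz (tau : R) : Prop :=
  exists2 C : R, 0 <= C & forall e : R, 0 < e ->
    \forall n \near U, forall r s, 0 <= r <= tau -> 0 <= s <= tau ->
      I n r /\ `|x n r - x n s| <= C * `|r - s| + e.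

Lemma asymp_lipschitz0 : asymp_lipschitz 0.
Proof.
exists 0 => // e e0; apply: filterE => n r s.
move=> /le_anti <- /le_anti <-; split; first exact: (x_init n).1.
by rewrite !subrr !normr0 mulr0 add0r ltW.
Qed.

Lemma asymp_lipschitz_le tau tau' : tau' <= tau ->
  asymp_lipschitz tau -> asymp_lipschitz tau'.
Proof.
move=> le_tau [C C0 xC]; exists C => // e /xC; apply: filterS => n H r s rt st.
by apply: H; lra.
Qed.

(** Near [p] the drift has speed at most [K] up to a vanishing error, so for a time [h] the solution
    stays near [p] and, being maximal, cannot end. Both [kappa] and [h] depend on [p] but not on
    [tau], which lets the induction pass to left limits. *)
Lemma asymp_lipschitz_extend (p : 'rV[R]_d) :
  exists2 kappa : R, 0 < kappa & exists2 h : R, 0 < h &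
    forall tau, 0 <= tau <= L -> asymp_lipschitz tau ->
      (\forall n \near U, `|x n tau - p| <= kappa) ->
      asymp_lipschitz (tau + h).
Proof.
have [k0 k00 fk0] := f_equicont p ltr01.
exists (k0 / 4); first by lra.
pose F := averaged f p; pose K := `|F| + 1.
have K0 : 0 < K by rewrite ltr_wpDl.
(* The bound 1 keeps times in [[0, L + 1]], where [drift_near] applies; the other gives
   [K * h <= k0 / 4]. *)
exists (Order.min 1 (k0 / 4 / K)).
  by rewrite lt_min ltr01 !divr_gt0.
set h := Order.min _ _; have h0 : 0 < h by rewrite lt_min ltr01 !divr_gt0.
have h1 : h <= 1 by rewrite ge_min lexx.
have Kh : K * h <= k0 / 4 by rewrite mulrC -ler_pdivlMr// ge_min lexx orbT.
move=> tau /andP[tau0 tauL] [C C0 xC] xtau.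
exists (C + K); first by rewrite addr_ge0// ltW.
move=> e e0; have e20 : 0 < e / 2 by lra.
have k80 : 0 < k0 / 8 by lra.
have near1 := xC _ e20; have near2 := drift_near p 1 e20.
have near3 := drift_near p 1 k80.
near=> n.
have xn_tau : `|x n tau - p| <= k0 / 4 by near: n.
have lip0 : forall r s, 0 <= r <= tau -> 0 <= s <= tau ->
  I n r /\ `|x n r - x n s| <= C * `|r - s| + e / 2 by near: n.
have Itau : I n tau by have [] := lip0 tau tau; rewrite ?tau0 ?lexx.
have small A : is_interval A -> A `<=` I n ->
    (forall c, A c -> tau <= c <= tau + h /\ `|x n c - p| < k0) ->
    forall c, A c -> 0 <= c <= L + 1 /\
       `|f (c / eps n) (x n c) - f (c / eps n) p| <= 1.
  move=> itvA AI Ak c Ac; have [ctau ck] := Ak c Ac; split; first by lra.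
  by apply/ltW/fk0 => //; rewrite divr_ge0 ?(ltW (eps_gt0 n))//; lra.
have drift2 : forall A : set R, is_interval A -> A `<=` I n ->
    (forall c, A c -> tau <= c <= tau + h /\ `|x n c - p| < k0) ->
    forall s t, A s -> A t -> `|x n s - x n t - (s - t) *: F| <= 1 * `|s - t| + e / 2.
  move=> A itvA AI Ak; have H := small A itvA AI Ak.
  by move: A itvA AI H {Ak}; near: n.
have drift3 : forall A : set R, is_interval A -> A `<=` I n ->
    (forall c, A c -> tau <= c <= tau + h /\ `|x n c - p| < k0) ->
    forall s t, A s -> A t -> `|x n s - x n t - (s - t) *: F| <= 1 * `|s - t| + k0 / 8.
  move=> A itvA AI Ak; have H := small A itvA AI Ak.
  by move: A itvA AI H {Ak}; near: n.
have lipF s t e' : `|x n s - x n t - (s - t) *: F| <= 1 * `|s - t| + e' ->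
    `|x n s - x n t| <= K * `|s - t| + e'.
  move=> le1; rewrite -[X in `|X|](subrK ((s - t) *: F)).
  by apply: le_trans (ler_normD _ _) _; rewrite normrZ /K; lra.
have stay c : I n c -> tau <= c <= tau + h -> `|x n c - p| < k0.
  move=> Ic /andP[tauc ch].
  have sub r : tau <= r <= c -> I n r by exact: x_itv.
  (* The bound [5 / 8 * k0] is [k0 / 4] for the start, [k0 / 4] for the drift and [k0 / 8] for the
     averaging error. *)
  apply: (@no_escape _ _ (x n) p tau c k0 (5 / 8 * k0)); last by rewrite tauc lexx.
  - by lra.
  - by lra.
  - move=> r /sub /x_deriv/deriv_on_continuous H e' /H[rho rho0 {}H].
    by exists rho => // s /sub; exact: H.
  move=> s /andP[taus sc] xs.
  have le2 : `|x n s - x n tau| <= K * `|s - tau| + k0 / 8.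
    apply: lipF; apply: (drift3 [set u | tau <= u <= s]); rewrite /= ?taus ?lexx//.
    + move=> a b /andP[ta _] /andP[_ bs] u /andP[au ub] /=.
      by rewrite (le_trans ta au) (le_trans ub bs).
    + by move=> u /andP[? us]; apply: sub; rewrite (le_trans us sc) andbT.
    + move=> u /[dup] us /andP[tauu us']; split; last exact: xs.
      by rewrite tauu (le_trans us')// (le_trans sc).
  have le3 : K * `|s - tau| <= K * h.
    by rewrite ler_pM2l// ger0_norm ?subr_ge0// lerBlDl (le_trans sc).
  rewrite -(subrK (x n tau) (x n s)) -addrA.
  apply: le_trans (ler_normD _ _) _.
  by lra.
have Ih : I n (tau + h).
  (* A solution not reaching [tau + h] would remain in bounded time and, by [stay], in a bounded
     ball. *)
  apply: contrapT => nIh.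
  have g_cont : continuous (fun q : R * 'rV[R]_d => f (q.1 / eps n) q.2).
    have c : continuous (fun t : R => t / eps n) by exact: mulrr_continuous.
    exact: (continuous_reparam c f_cont).
  apply: (maximal_solution_escapes g_cont (x_max n) (t0 := tau) (T := tau + h)
    (B := `|p| + k0) Itau) => r Ir taur.
  have rh : r <= tau + h.
    case: leP => // hr; exfalso; apply: nIh.
    by apply: (x_itv Itau Ir); lra.
  split => //; rewrite -(subrK p (x n r)) addrC.
  apply: le_trans (ler_normD _ _) _; rewrite lerD2l ltW//.
  by apply: stay => //; lra.
have sub r : tau <= r <= tau + h -> I n r by exact: x_itv.
have lip1 r s : tau <= r <= tau + h -> tau <= s <= tau + h ->
    `|x n r - x n s| <= K * `|r - s| + e / 2.
  move=> rt st; apply: lipF.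
  apply: (drift2 [set u | tau <= u <= tau + h]) => //.
  - move=> a b /andP[ta _] /andP[_ bs] u /andP[au ub] /=.
    by rewrite (le_trans ta au) (le_trans ub bs).
  - by move=> u ut; split => //; apply: stay => //; exact: sub.
move=> r s rt st; split.
  have [rtau|/ltW taur] := leP r tau.
    by have [] := lip0 r tau; rewrite ?tau0 ?lexx ?rtau ?(andP rt).1.
  by apply: sub; rewrite taur (andP rt).2.
have -> : e = 2 * (e / 2) by rewrite mulrC divfK.
apply: (@lipschitz_glue _ _ (x n) 0 tau (tau + h)) => //.
- exact: ltW.
- exact: ltW.
- by rewrite tau0 lerDl ltW.
- by move=> u v ut vt; have [] := lip0 u v ut vt.
Unshelve. all: by end_near.
Qed.

Lemma asymp_lipschitz_cvg tau t : asymp_lipschitz tau -> 0 <= t <= tau ->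
  exists l : 'rV[R]_d, x ^~ t @ U --> l.
Proof.
move=> [C C0 xC] /andP[t0 ttau].
apply: (@ultra_cvg_bounded _ _ U _ _ _ (`|x0| + (C * t + 1))).
apply: filterS (xC 1 ltr01) => n xCn.
have [|| _] := xCn t 0; [by rewrite t0|by rewrite lexx (le_trans t0)|].
rewrite subr0 (ger0_norm t0) (x_init n).2 => le1.
rewrite -[X in `|X|](subrK x0) addrC.
by apply: le_trans (ler_normD _ _) _; rewrite lerD2l.
Qed.

(** For times near [t], almost all [x n] are close to [z t], so [drift_near] with [p = z t] compares
    their increments with the slope [averaged f (z t)]; the inequality passes to the ultralimit. *)
Lemma limit_deriv tau (z : R -> 'rV[R]_d) : tau <= L -> asymp_lipschitz tau ->
  (forall t, 0 <= t <= tau -> x ^~ t @ U --> z t) ->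
  forall t, 0 <= t <= tau -> deriv_on `[0, tau] z t (averaged f (z t)).
Proof.
move=> tauL [C C0 xC] xz t t0tau eta eta0.
have [k k0 fk] := f_equicont (z t) eta0.
have k40 : 0 < k / 4 by lra.
have C10 : 0 < C + 1 by lra.
(* Three errors below or equal to [k / 4] add up to less than [k]: the Lipschitz part, its vanishing
   error, and the distance from [x n t] to [z t]. *)
exists (k / 4 / (C + 1)) => [|s]; first exact: divr_gt0.
rewrite /= in_itv /= ltr_pdivlMr// => s0tau st.
have XB : x n s - x n t @[n --> U] --> z s - z t by apply: cvgB; exact: xz.
apply: (ultra_cvg_dist_le XB) => e e0.
(* An interval containing [s] and [t] whatever their order. *)
pose A := [set c | 0 <= c <= tau /\ `|c - t| <= `|s - t|].
have itvA : is_interval A.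
  move=> a b [a1 a2] [b1 b2] c acb.
  by move: a2 b2; rewrite /A /= !ler_norml => a2 b2; split; [lra|lra].
have near3 : \forall n \near U, `|z t - x n t| < k / 4.
  by move/cvgrPdist_lt: (xz t t0tau); apply.
apply: filterS3 (drift_near (z t) eta e0) (xC _ k40) near3 => n drift lip xzt.
apply: (drift A itvA) => [c [c1 c2]|c [c1 c2]||].
- by have [] := lip c c c1 c1.
- split; first by have := c1; lra.
  apply/ltW/fk; first by rewrite divr_ge0 ?(ltW (eps_gt0 n))//; case/andP: c1.
  have [_ le1] := lip c t c1 t0tau.
  rewrite -(subrK (x n t) (x n c)) -addrA; apply: le_lt_trans (ler_normD _ _) _.
  rewrite (distrC _ (z t)).
  have : C * `|c - t| <= C * `|s - t| by rewrite ler_wpM2l.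
  have : 0 <= `|s - t| by [].
  by lra.
- by split.
- by split; rewrite // subrr normr0.
Qed.

Variables (J : set R) (y : R -> 'rV[R]_d).
Hypothesis y_sol : solution (fun=> averaged f) x0 J y.
Hypothesis y_unique : forall I' z, solution (fun=> averaged f) x0 I' z ->
  restriction_of I' z J y.

Lemma limit_is_averaged_solution tau : tau <= L -> asymp_lipschitz tau ->
  forall t, 0 <= t <= tau -> J t /\ x ^~ t @ U --> y t.
Proof.
move=> tauL xC t t0tau; have [[_ J0 _ _] y0 _] := y_sol.
have x0E : x ^~ 0 = fun=> x0 by apply/funext => n; exact: (x_init n).2.
(* A forward interval contains a positive time, so uniqueness can be invoked only for [tau > 0]; at
   time 0 the initial condition suffices. *)
have [tau0|tau0] := leP tau 0.
  have -> : t = 0 by lra.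
  by rewrite y0 x0E; split => //; exact: cvg_cst.
have [z xz] : {z : R -> 'rV[R]_d &
    forall t, 0 <= t <= tau -> x ^~ t @ U --> z t}.
  apply: (@choice _ _ (fun t l => 0 <= t <= tau -> x ^~ t @ U --> l)) => r.
  have [r0tau|_] := boolP (0 <= r <= tau); last by exists 0.
  by have [l xl] := asymp_lipschitz_cvg xC r0tau; exists l.
have dz := limit_deriv tauL xC xz.
have itvE r : `[0, tau]%classic r <-> 0 <= r <= tau by rewrite /= in_itv.
have zsol : solution (fun=> averaged f) x0 `[0, tau] z.
  split.
  - split.
    + exact: interval_is_interval.
    + by apply/itvE; rewrite lexx ltW.
    + by move=> r /itvE /andP[].
    + by exists tau => //; apply/itvE; rewrite lexx ltW.
  - have : x ^~ 0 @ U --> z 0 by apply: xz; rewrite lexx ltW.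
    rewrite x0E => x0z; apply/eqP; rewrite -subr_eq0 -normr_le0.
    apply: (ultra_cvg_dist_le x0z) => e e0; apply: filterE => n.
    by rewrite subrr normr0 add0r ltW.
  - by move=> r /itvE r0; apply/has_deriv_withinP; exact: dz.
have [JI zy] := y_unique zsol.
have tI : `[0, tau]%classic t by apply/itvE.
by split; [exact: JI|rewrite -zy//; exact: xz].
Qed.

Hypothesis J_L : J L.

Lemma J_sub t : 0 <= t <= L -> J t.
Proof.
by have [[itvJ J0 _ _] _ _] := y_sol; exact: itvJ.
Qed.

Lemma y_continuous t : 0 <= t <= L -> forall e : R, 0 < e ->
  exists2 rho : R, 0 < rho &
    forall s, 0 <= s <= L -> `|s - t| < rho -> `|y s - y t| < e.
Proof.
move=> tL e e0; have [_ _ dy] := y_sol.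
have [rho rho0 H] := deriv_on_continuous ((has_deriv_withinP _ _ _ _).1 (dy t (J_sub tL))) e0.
by exists rho => // s /J_sub; exact: H.
Qed.

(** Real induction on the length of the interval. At each stage the limit is known to be [y], so
    [asymp_lipschitz_extend] is applied with centre [y c]. *)
Lemma asymp_lipschitzL : asymp_lipschitz L.
Proof.
apply: (@real_induction _ asymp_lipschitz 0 L); last by rewrite L_ge0 lexx.
- exact: asymp_lipschitz0.
- move=> c /andP[c0 cL] xC.
  have xCc : asymp_lipschitz c by apply: xC; rewrite c0 lexx.
  have [kappa kappa0 [h h0 ext]] := asymp_lipschitz_extend (y c).
  have [_ xyc] := limit_is_averaged_solution (ltW cL) xCc
    (introT andP (conj c0 (lexx c))).
  have xCh : asymp_lipschitz (c + h).
    apply: ext => //; first by rewrite c0 ltW.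
    by move/cvgrPdist_le : xyc => /(_ _ kappa0); apply: filterS => n; rewrite distrC.
  exists (c + h); first by rewrite ltrDl.
  by move=> r /andP[_ rc]; exact: asymp_lipschitz_le xCh.
- move=> c /andP[c0 cL] xC.
  have [kappa kappa0 [h h0 ext]] := asymp_lipschitz_extend (y c).
  have cL' : 0 <= c <= L by rewrite cL ltW.
  have k20 : 0 < kappa / 2 by lra.
  have [rho rho0 yrho] := y_continuous cL' k20.
  (* Starting slightly before [c], the gap is at most [h], so the extension covers [c]. Continuity
     puts [y tau] within [kappa / 2] of [y c], leaving [kappa / 2] for [x n tau]. *)
  pose tau := Order.max 0 (c - Order.min h (rho / 2)).
  have m0 : 0 < Order.min h (rho / 2) by rewrite lt_min h0; lra.
  have mh : Order.min h (rho / 2) <= h by rewrite ge_min lexx.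
  have mr : Order.min h (rho / 2) <= rho / 2 by rewrite ge_min lexx orbT.
  have tau0 : 0 <= tau by rewrite le_max lexx.
  have taum : c - Order.min h (rho / 2) <= tau by rewrite le_max lexx orbT.
  have tauc : tau < c by rewrite gt_max c0; lra.
  have tauL : 0 <= tau <= L by lra.
  have xCtau : asymp_lipschitz tau by apply: xC; rewrite tau0.
  have [_ xytau] := limit_is_averaged_solution (andP tauL).2 xCtau
    (introT andP (conj tau0 (lexx tau))).
  have ytau : `|y tau - y c| < kappa / 2.
    by apply: yrho => //; rewrite ltr0_norm; lra.
  apply: (@asymp_lipschitz_le (tau + h)); first by lra.
  apply: ext => //; move/cvgrPdist_le : xytau => /(_ _ k20); apply: filterS => n le1.
  rewrite -(subrK (y tau) (x n tau)) -addrA; apply: le_trans (ler_normD _ _) _.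
  by rewrite distrC; lra.
Qed.

(** Pointwise convergence becomes uniform: times [t n] where the gap is at least [delta] would
    converge along [U] to some [s], and the asymptotic Lipschitz bound, continuity of [y] and
    convergence at [s] exclude this. *)
Lemma solutions_close (delta : R) : 0 < delta ->
  \forall n \near U, forall t, 0 <= t <= L -> I n t /\ `|x n t - y t| < delta.
Proof.
move=> delta0; have [C C0 xC] := asymp_lipschitzL.
have d40 : 0 < delta / 4 by lra.
have nearI : \forall n \near U, forall t, 0 <= t <= L -> I n t.
  by apply: filterS (xC 1 ltr01) => n H t tL; have [] := H t t tL tL.
suff nearx : \forall n \near U, forall t, 0 <= t <= L -> `|x n t - y t| < delta.
  by apply: filterS2 nearI nearx => n In xn t tL; split; [exact: In|exact: xn].
have [//|farx] := in_ultra_setVsetC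
  [set n | forall t, 0 <= t <= L -> `|x n t - y t| < delta] UU.
have [t tP] : {t : T -> R & forall n, ~ (forall t, 0 <= t <= L -> `|x n t - y t| < delta) ->
    0 <= t n <= L /\ delta <= `|x n (t n) - y (t n)|}.
  apply: (@choice _ _ (fun n s => ~ (forall t, 0 <= t <= L -> `|x n t - y t| < delta) ->
    0 <= s <= L /\ delta <= `|x n s - y s|)) => n.
  have [H|/existsNP[s /not_implyP[sL /negP]]] :=
    pselect (forall t, 0 <= t <= L -> `|x n t - y t| < delta); first by exists 0.
  by rewrite -leNgt => sd; exists s.
have [|s sL ts] := ultra_cvg_compact (U := U) (u := t) (@segment_compact _ 0 L).
  by apply: filterS farx => n /tP[tL _]; rewrite /= in_itv.
rewrite /= in_itv /= in sL.
have [rho rho0 yrho] := y_continuous sL d40.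
have C10 : 0 < C + 1 by lra.
have dC : 0 < delta / 4 / (C + 1) by rewrite divr_gt0.
have near1 : \forall n \near U, `|s - t n| < Order.min rho (delta / 4 / (C + 1)).
  by move/cvgrPdist_lt : ts; apply; rewrite lt_min rho0.
have [_ xys] := limit_is_averaged_solution (lexx L) asymp_lipschitzL sL.
have near2 : \forall n \near U, `|y s - x n s| < delta / 4.
  by move/cvgrPdist_lt : xys; apply.
have [n [[[tn xn] lip] xyn]] : exists n, ((`|s - t n| < Order.min rho (delta / 4 / (C + 1)) /\
    ~ (forall t, 0 <= t <= L -> `|x n t - y t| < delta)) /\
    (forall r s, 0 <= r <= L -> 0 <= s <= L ->
      I n r /\ `|x n r - x n s| <= C * `|r - s| + delta / 4)) /\
    `|y s - x n s| < delta / 4.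
  apply: (@filter_ex _ U).
  by apply: filterI near2; apply: filterI (xC _ d40); exact: filterI.
have [tL far] := tP n xn.
have [_ le1] := lip (t n) s tL sL.
move: tn; rewrite lt_min distrC => /andP[tn1]; rewrite ltr_pdivlMr// => tn2.
have le2 := yrho _ tL tn1.
exfalso; move: far; apply/negP; rewrite -ltNge.
(* The first difference is below [delta / 2], the two others below [delta / 4] each. *)
have -> : x n (t n) - y (t n) =
    (x n (t n) - x n s) - (y s - x n s) - (y (t n) - y s).
  by rewrite opprB addrA subrK opprB addrA subrK.
apply: le_lt_trans (ler_normB _ _) _.
have := ler_normB (x n (t n) - x n s) (y s - x n s).
have : 0 <= `|t n - s| by [].
by lra.
Qed.

End UltraLimitOfSolutions.

(** * Equivalence of norms and conclusion *)

Section NormEquivalence.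
Context {R : realType} {d : nat} (N : 'rV[R]_d -> R).
Hypothesis N_norm : is_norm N.

Lemma norm_origin : N 0 = 0.
Proof. by have [_ NZ _] := N_norm; rewrite -(scale0r 0) NZ normr0 mul0r. Qed.

Lemma norm_opp u : N (- u) = N u.
Proof. by have [_ NZ _] := N_norm; rewrite -scaleN1r NZ normrN1 mul1r. Qed.

Lemma norm_nonneg u : 0 <= N u.
Proof.
have [ND _ _] := N_norm; have := ND u (- u).
by rewrite subrr norm_origin norm_opp; lra.
Qed.

Lemma norm_le_sup : exists2 c : R, 0 < c & forall u, N u <= c * `|u|.
Proof.
have [ND NZ _] := N_norm.
exists (\sum_(i < d) N (delta_mx 0 i) + 1) => [|u].
  by rewrite ltr_wpDl// sumr_ge0// => i _; exact: norm_nonneg.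
have -> : N u = N (\sum_(i < d) u 0 i *: delta_mx 0 i) by rewrite -row_sum_delta.
apply: (@le_trans _ _ (\sum_(i < d) N (u 0 i *: delta_mx 0 i))).
  apply: (big_ind2 (fun v k => N v <= k)) => //; first by rewrite norm_origin.
  by move=> v k v' k' vk vk'; apply: le_trans (ND _ _) _; exact: lerD.
rewrite mulrDl mul1r ler_wpDr// mulr_suml ler_sum// => i _.
by rewrite NZ mulrC ler_wpM2l ?norm_nonneg// rV_coord_le_norm.
Qed.

Lemma norm_continuous_sup : continuous N.
Proof.
have [ND _ _] := N_norm; have [c c0 Nc] := norm_le_sup.
move=> u; apply: (cvgrPdist_lt (F := nbhs u) N (N u)).2 => e e0.
apply/nbhs_ballP; exists (e / c) => /=; first exact: divr_gt0.
move=> v; rewrite -ball_normE /ball_ /= ltr_pdivlMr// mulrC => uv.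
apply: le_lt_trans uv; apply: le_trans (Nc _); rewrite ler_norml.
have := ND (u - v) v; have := ND (v - u) u; rewrite !subrK.
by rewrite -(opprB u v) norm_opp; lra.
Qed.

(** The continuous [N] attains its minimum on the compact unit sphere; definiteness makes the
    minimum positive, and homogeneity does the rest. *)
Lemma sup_le_norm : exists2 c : R, 0 < c & forall u, `|u| <= c * N u.
Proof.
have [ND NZ N0] := N_norm.
pose S := [set u : 'rV[R]_d | `|u| = 1].
have unitS u : u != 0 -> S (`|u|^-1 *: u).
  by move=> u0; rewrite /S /= normrZ normfV normr_id mulVf// normr_eq0.
have [S0|nS0] := pselect (S !=set0); last first.
  exists 1 => // u; have [->|u0] := eqVneq u 0.
    by rewrite normr0 mul1r norm_nonneg.
  by exfalso; apply: nS0; exists (`|u|^-1 *: u); exact: unitS.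
have cS : compact S.
  apply: (subclosed_compact _ (compact_norm_le (B := 1))); last by move=> u /= ->.
  apply: (@closed_comp _ _ (fun v : 'rV[R]_d => `|v|) [set r | r = 1]).
    by move=> v _; exact: norm_continuous.
  exact: closed_eq.
have [u0 u0S u0min] := EVT_min_rV S0 cS (continuous_subspaceT norm_continuous_sup).
have m0 : 0 < N u0.
  rewrite lt_neqAle norm_nonneg andbT eq_sym; apply/eqP => /N0 u00.
  by move: u0S; rewrite inE /S /= u00 normr0 => /esym/eqP; rewrite oner_eq0.
exists (N u0)^-1 => [|u]; first by rewrite invr_gt0.
have [->|un0] := eqVneq u 0.
  by rewrite normr0 mulr_ge0 ?norm_nonneg// ltW// invr_gt0.
have := u0min _ (mem_set (unitS u un0)); rewrite NZ normfV normr_id => le1.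
by rewrite mulrC ler_pdivlMr// mulrC -ler_pdivlMr ?normr_gt0// mulrC.
Qed.

End NormEquivalence.

(** * Extension to negative times and the averaging theorem *)

Lemma maximal_solution_eq (R : realType) d (g g' : R -> 'rV[R]_d -> 'rV[R]_d)
    x0 I x :
  (forall t u, 0 <= t -> g t u = g' t u) ->
  maximal_solution g x0 I x -> maximal_solution g' x0 I x.
Proof.
have sol_eq h h' I' x' : (forall t u, 0 <= t -> h t u = h' t u :> 'rV[R]_d) ->
    solution h x0 I' x' -> solution h' x0 I' x'.
  move=> hE [fI x'0 dx']; split => // t It; rewrite -hE; first exact: dx'.
  by have [_ _ I0 _] := fI; exact: I0.
move=> gE [xs xM]; split => [|I' x' s' r']; first exact: sol_eq xs.
by apply: (xM I' x') r'; apply: sol_eq s' => t u t0; rewrite gE.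
Qed.

(** The map [Num.max t 0] retracts the line onto the half-line where [f] is continuous, which gives
    a globally continuous field frozen at its value for [t = 0]. *)
Lemma continuous_clamp (R : realType) d (f : R -> 'rV[R]_d -> 'rV[R]_d) :
  {within [set p : R * 'rV[R]_d | 0 <= p.1],
     continuous (fun p : R * 'rV[R]_d => f p.1 p.2)} ->
  continuous (fun p : R * 'rV[R]_d => f (Num.max p.1 0) p.2).
Proof.
move=> /subspace_continuousP cf p.
have cq : {for p, continuous (fun q : R * 'rV[R]_d => (Num.max q.1 0, q.2))}.
  have cmax : continuous (fun t : R => Num.max t 0).
    by move=> t; apply: continuous_max; [exact: cvg_id|exact: cvg_cst].
  exact: (@continuous_map_fst _ _ _ _ cmax).
have /cf : [set p : R * 'rV[R]_d | 0 <= p.1] (Num.max p.1 0, p.2).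
  by rewrite /= le_max lexx orbT.
move=> H W /H; rewrite /= => {}H; have := cq _ H.
rewrite /nbhs /=.
apply: filterS => q /=; apply.
by rewrite le_max lexx orbT.
Qed.

Unset Implicit Arguments.

Theorem theorem2p1 (R : realType) (d : nat) (d_ge1 : (1 <= d)%N)
  (N : 'rV[R]_d -> R) (N_norm : is_norm N)
  (f : R -> 'rV[R]_d -> 'rV[R]_d)
  (f_cont : {within [set p : R * 'rV[R]_d | 0 <= p.1],
               continuous (fun p : R * 'rV[R]_d => f p.1 p.2)})
  (x0 : 'rV[R]_d)
  (C1 : forall (x : 'rV[R]_d) (eta : R), 0 < eta ->
     exists2 kappa : R, 0 < kappa &
       forall (t : R) (x' : 'rV[R]_d), 0 <= t -> N (x' - x) < kappa ->
         N (f t x' - f t x) < eta)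
  (C2 : forall x : 'rV[R]_d, cvg (time_average f x @ +oo))
  (C3 : has_unique_solution (fun _ : R => averaged f) x0)
  (J : set R) (y : R -> 'rV[R]_d)
  (y_sol : maximal_solution (fun _ : R => averaged f) x0 J y)
  (L : R) (L_in_J : J L)
  (delta : R) (delta_gt0 : 0 < delta) :
  exists2 eps0 : R, 0 < eps0 &
    forall eps : R, 0 < eps -> eps <= eps0 ->
    forall (I : set R) (x : R -> 'rV[R]_d),
      maximal_solution (fun t u => f (t / eps) u) x0 I x ->
      `[0, L] `<=` I /\
      forall t : R, 0 <= t -> t <= L -> N (x t - y t) < delta.
Proof.
have [c c0 Nle] := norm_le_sup N_norm; have [c' c'0 leN] := sup_le_norm N_norm.
(* Solutions, averages and (C1) only see times [t >= 0], so [f] may be replaced by its continuous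
   extension [fp]. *)
have [fp fpE fp_cont] : exists2 fp : R -> 'rV[R]_d -> 'rV[R]_d,
    forall t u, 0 <= t -> fp t u = f t u &
    continuous (fun p : R * 'rV[R]_d => fp p.1 p.2).
  exists (fun t => f (Num.max t 0)); last exact: continuous_clamp.
  by move=> t u t0; rewrite max_l.
have avgE : time_average fp = time_average f.
  apply/funext => p; apply/funext => T; congr (_ *: _); apply/rowP => i.
  rewrite !mxE; apply: eq_Rintegral => t; rewrite inE /= in_itv /= => /andP[t0 _].
  by rewrite fpE.
have FE : averaged fp = averaged f by rewrite /averaged avgE.
have fp_equi p eta : 0 < eta -> exists2 kappa : R, 0 < kappa &
    forall t u, 0 <= t -> `|u - p| < kappa -> `|fp t u - fp t p| < eta.
  move=> eta0; have [k k0 fk] := C1 p _ (divr_gt0 eta0 c'0).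
  exists (k / c) => [|t u t0]; first exact: divr_gt0.
  rewrite ltr_pdivlMr// mulrC => up; rewrite (fpE t u t0) (fpE t p t0).
  apply: le_lt_trans (leN _) _; rewrite mulrC -ltr_pdivlMr//.
  by apply: fk => //; exact: le_lt_trans (Nle _) up.
have fp_avg p : cvg (time_average fp p @ +oo) by rewrite avgE; exact: C2.
have [[[_ _ J0 _] _ _] _] := y_sol; have L0 : 0 <= L by exact: J0.
have y_uniq I' z : solution (fun=> averaged fp) x0 I' z -> restriction_of I' z J y.
  have [J' [y' [_ maxU solU]]] := C3; have [JE yE] := maxU _ _ y_sol.
  rewrite FE JE => /solU [sub zE]; split=> [|t It]; first exact: sub.
  by rewrite (zE t It) (yE t (sub t It)).
have ysol : solution (fun=> averaged fp) x0 J y by rewrite FE; exact: y_sol.1.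
(* A counterexample with parameter at most [e], as a triple of parameter, interval and solution.
   Failure of the theorem supplies one for each [e = n.+1^-1]. *)
pose bad (e : R) (q : R * set R * (R -> 'rV[R]_d)) := 0 < q.1.1 /\ q.1.1 <= e /\
  maximal_solution (fun t u => fp (t / q.1.1) u) x0 q.1.2 q.2 /\
  ~ (`[0, L] `<=` q.1.2 /\ forall t, 0 <= t -> t <= L -> N (q.2 t - y t) < delta).
apply: contrapT => nconv.
have [q qbad] : {q : nat -> R * set R * (R -> 'rV[R]_d) & forall n, bad n.+1%:R^-1 (q n)}.
  apply: (@choice _ _ (fun n q => bad n.+1%:R^-1 q)) => n; apply: contrapT => nbad.
  apply: nconv; exists n.+1%:R^-1; first by rewrite invr_gt0.
  move=> e e0 en I x xmax; apply: contrapT => far.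
  apply: nbad; exists (e, I, x).
  split; first exact: e0.
  split; first exact: en.
  split; last exact: far.
  apply: maximal_solution_eq xmax => t u t0.
  by rewrite fpE; last exact: divr_ge0 t0 (ltW e0).
have [U [UU subU]] := @ultraFilterLemma nat \oo _.
have epsU e : 0 < e -> \forall n \near U, (q n).1.1 <= e.
  move=> e0; apply: subU; apply: filterS (near_infty_natSinv_lt (PosNum e0)) => n /= ne.
  by have [_ [le1 _]] := qbad n; exact: le_trans le1 (ltW ne).
(* The closeness is obtained in the sup norm, so [delta / c] is requested to get [delta] for [N]. *)
have close := solutions_close fp_cont fp_equi fp_avg (U := U)
  (x0 := x0) (eps := fun n => (q n).1.1) (I := fun n => (q n).1.2)
  (x := fun n => (q n).2) (fun n => (qbad n).1) epsU (fun n => (qbad n).2.2.1)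
  L0 ysol y_uniq L_in_J (divr_gt0 delta_gt0 c0).
have [n nP] := @filter_ex _ U _ _ (close UU).
have [_ [_ [_ far]]] := qbad n; apply: far; split=> [t|t t0 tL].
  by rewrite /= in_itv /= => /nP[].
have [|_] := nP t; first by rewrite t0.
rewrite ltr_pdivlMr// mulrC => le1.
exact: le_lt_trans (Nle _) le1.
Qed.
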